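(* Consider the sub-Gaussian mixture model with adversarial outliers and the $k$-medians-hybrid algorithm described in the context. Suppose that the adversary, after seeing $Y_1,\dots,Y_n$, adds $n^{\mathrm{out}} = n\alpha(1-\delta)$ outliers of its choice, for some $\delta\in(0,1]$. Then there exist absolute constants $C,c_0,c_1,c_2,c_4>0$ such that the following holds. If $n\alpha\ge c_0\log n$, $$\sqrt{\delta}\cdot \mathrm{SNR}\sqrt{\alpha/d} > C,$$ and the initialization satisfies $$H_0\ \ge\ \frac12+\frac{c_1}{\big(\mathrm{SNR}\sqrt{\alpha/d}\big)^2}\qquad\text{or}\qquad \Lambda_0\ \le\ \frac12-\frac{c_2}{\Big(\sqrt{\delta}\cdot\mathrm{SNR}\sqrt{\frac{\alpha}{1+dk/n}}\Big)^{1/2}},$$ then with probability at least $1-4(k^2+k)n^{-4}-16dn^4e^{-0.3n}-2k^2\exp\{-\mathrm{SNR}/4\}$, $$\ell(\hat z^{(s)},z)\ \le\ \exp\Big\{-\frac12\Big(1-\frac{c_4}{(\sqrt{\delta}\cdot\mathrm{SNR}\sqrt{\alpha/d})^{1/2}}\Big)\mathrm{SNR}^2\Big\}\qquad\text{for all } s\ge 2.$$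
   Context: Model: observed data $Y_1,\dots,Y_n\in\mathbb{R}^d$ satisfy $Y_i=\theta_{z_i}+w_i$, where $z=(z_1,\dots,z_n)\in[k]^n$ are unknown labels, $\theta_1,\dots,\theta_k\in\mathbb{R}^d$ are unknown centroids, and $w_1,\dots,w_n$ are independent zero-mean sub-Gaussian vectors with parameter $\sigma>0$, i.e. $\mathbb{E}[e^{\langle a,w_i\rangle}]\le e^{\sigma^2\|a\|^2/2}$ for all $a\in\mathbb{R}^d$ and all $i$. $\|\cdot\|$ is the Euclidean norm. Let $T_g^*=\{i\in[n]:z_i=g\}$, $n_g^*=|T_g^*|$, $\alpha=\min_{g\in[k]}n_g^*/n$, $\Delta=\min_{g\ne h}\|\theta_g-\theta_h\|$, and $\mathrm{SNR}=\Delta/(2\sigma)$. Outliers: after observing $Y_1,\dots,Y_n$, an adversary adds $n^{\mathrm{out}}$ arbitrary points of $\mathbb{R}^d$; the algorithm runs on all $n+n^{\mathrm{out}}$ points. Order statistics: for a finite multiset of reals $\{v_1,\dots,v_m\}$, $v^{(1)}\ge v^{(2)}\ge\dots\ge v^{(m)}$. The coordinatewise median of a finite multiset of $m$ vectors is the vector whose $j$-th coordinate is the $\lceil m/2\rceil$-th largest of the $j$-th coordinates. Algorithm ($k$-medians-hybrid): at step $s$ every point (true or outlier) carries a label $\hat z^{(s)}\in[k]$; $T_h^{(s)}$ is the set of all points (true and outliers) with label $h$; the centroid estimate $\hat\theta_h^{(s)}$ is the coordinatewise median of the points in $T_h^{(s)}$; the new labels are $\hat z^{(s+1)}(y)=\arg\min_{h\in[k]}\|y-\hat\theta_h^{(s)}\|^2$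 (ties broken arbitrarily). The initialization ($s=0$) is given either as initial labels $\hat z^{(0)}$ (from which $\hat\theta^{(0)}$ is computed) or as initial centroids $\hat\theta^{(0)}$. Quantities: $n_h^{(s)}=|T_h^{(s)}|$ (including outliers); $n_{hg}^{(s)}=|\{i\in T_h^*:\hat z_i^{(s)}=g\}|$ (true points only); $H_s=\min_{g\in[k]}\min\{n_{gg}^{(s)}/n_g^*,\,n_{gg}^{(s)}/n_g^{(s)}\}$; $\Lambda_s=\max_{h\in[k]}\|\hat\theta_h^{(s)}-\theta_h\|/\Delta$; mislabeling proportion on the true points $\ell(\hat z^{(s)},z)=\frac1n\sum_{i=1}^n\mathbf{1}\{\hat z_i^{(s)}\ne z_i\}$. *)

(* Defs.v *)
From HB Require Import structures.
From mathcomp Require Import all_boot all_order all_algebra.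
From mathcomp Require Import all_classical all_reals all_analysis.
Set Implicit Arguments. Unset Strict Implicit. Unset Printing Implicit Defensive.
Import Order.TTheory GRing.Theory Num.Theory.
Local Open Scope classical_set_scope.
Local Open Scope ring_scope.

Section Defs.
Variable R : realType.

Definition vec (d : nat) := 'I_d -> R.

Definition dotv d (a b : vec d) : R := \sum_(j < d) a j * b j.
Definition sqnormv d (a : vec d) : R := \sum_(j < d) a j ^+ 2.
Definition normv d (a : vec d) : R := Num.sqrt (sqnormv a).
Definition vaddv d (a b : vec d) : vec d := fun j => a j + b j.
Definition vsubv d (a b : vec d) : vec d := fun j => a j - b j.

Definition fmin (I : finType) (P : pred I) (f : I -> R) : R :=
  match [pick i | P i] with
  | Some i0 => \big[Num.min/f i0]_(i | P i) f i
  | None => 0 end.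
Definition fmax (I : finType) (P : pred I) (f : I -> R) : R :=
  match [pick i | P i] with
  | Some i0 => \big[Num.max/f i0]_(i | P i) f i
  | None => 0 end.

(* ceil(m/2)-th largest element of a finite multiset of reals
   (0 for the empty multiset, a convention) *)
Definition med_real (s : seq R) : R :=
  nth 0 (sort (fun x y : R => y <= x) s) (uphalf (size s)).-1.

Definition cmedian d (s : seq (vec d)) : vec d :=
  fun j => med_real [seq v j | v <- s].

Definition nstar n k (z : 'I_n -> 'I_k) (g : 'I_k) : nat := #|[set i | z i == g]|.

Definition alpha n k (z : 'I_n -> 'I_k) : R :=
  fmin predT (fun g => (nstar z g)%:R / n%:R).

Definition Delta k d (theta : 'I_k -> vec d) : R :=
  fmin (fun p : 'I_k * 'I_k => p.1 != p.2)
       (fun p => normv (vsubv (theta p.1) (theta p.2))).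

Definition SNR k d (theta : 'I_k -> vec d) (sigma : R) : R :=
  Delta theta / (2 * sigma).

(* ---- algorithm quantities; points = true points (inl) + outliers (inr) ---- *)
Definition cluster_pts n m k d (pt : 'I_n + 'I_m -> vec d)
  (zh : 'I_n + 'I_m -> 'I_k) (h : 'I_k) : seq (vec d) :=
  [seq pt x | x <- enum [pred x | zh x == h]].

Definition nhg n m k (z : 'I_n -> 'I_k) (zh : 'I_n + 'I_m -> 'I_k) (h g : 'I_k) : nat :=
  #|[set i | (z i == h) && (zh (inl i) == g)]|.
Definition nh n m k (zh : 'I_n + 'I_m -> 'I_k) (h : 'I_k) : nat :=
  #|[set x | zh x == h]|.

Definition Hs n m k (z : 'I_n -> 'I_k) (zh : 'I_n + 'I_m -> 'I_k) : R :=
  fmin predT (fun g => Num.min ((nhg z zh g g)%:R / (nstar z g)%:R)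
                               ((nhg z zh g g)%:R / (nh zh g)%:R)).

Definition Lambdas k d (theta thetah : 'I_k -> vec d) : R :=
  fmax predT (fun h => normv (vsubv (thetah h) (theta h)) / Delta theta).

Definition misl n m k (zh : 'I_n + 'I_m -> 'I_k) (z : 'I_n -> 'I_k) : R :=
  (#|[set i | zh (inl i) != z i]|)%:R / n%:R.

(* A run of k-medians-hybrid on the points pt:
   theta_h^(s) is the coordinatewise median of T_h^(s) (for s >= 1; for s = 0
   this is the case only for label initialization, see the theorem),
   and zh^(s+1)(y) is a minimizer of h |-> ||y - theta_h^(s)||^2 (any tie-breaking). *)
Definition kmed_run n m k d (pt : 'I_n + 'I_m -> vec d)
  (zh : nat -> 'I_n + 'I_m -> 'I_k) (th : nat -> 'I_k -> vec d) : Prop :=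
  (forall s h, (0 < s)%N -> th s h = cmedian (cluster_pts pt (zh s) h)) /\
  (forall s x h, sqnormv (vsubv (pt x) (th s (zh s.+1 x))) <= sqnormv (vsubv (pt x) (th s h))).

Definition gen_sigma dm (Omega : measurableType dm) d (X : Omega -> vec d) : set (set Omega) :=
  <<s [set A | exists j B, measurable B /\ A = (fun om => X om j) @^-1` B] >>.

Definition mutually_independent dm (Omega : measurableType dm) (P : probability Omega R)
  n d (w : 'I_n -> Omega -> vec d) : Prop :=
  forall (J : {set 'I_n}) (A : 'I_n -> set Omega),
    (forall i, i \in J -> gen_sigma (w i) (A i)) ->
    P (\bigcap_(i in [set i | i \in J]) A i) = (\prod_(i in J) P (A i))%E.

Definition subgaussian_zero_mean dm (Omega : measurableType dm) (P : probability Omega R)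
  d (X : Omega -> vec d) (sigma : R) : Prop :=
  (forall j, measurable_fun setT (fun om => X om j)) /\
  (forall j, P.-integrable setT (fun om => (X om j)%:E)) /\
  (forall j, (\int[P]_om (X om j)%:E = 0)%E) /\
  (forall a : vec d,
     (\int[P]_om (expR (dotv a (X om)))%:E <= (expR (sigma ^+ 2 * sqnormv a / 2))%:E)%E).

End Defs.

(* Main.v *)
(* A true point [i] of cluster [g] gets label [h] only if
   [2 <v, w_i> + 2 <u, w_i> >= |v|^2 - 2 r |v|], where [v = theta_h - theta_g], [r] bounds
   the centroid errors and [u] is the difference of two of them, hence [|u| <= 2 r].
   The fixed directions [v] are handled by Chernoff and Markov bounds on the number of
   offending points.  The data-dependent direction [u] is handled in two ways.  While [r]
   is a constant fraction of [Delta], the set [A] of points tilted towards [u] has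
   [|sum_(i in A) w_i|] of order [|A| Delta], and a bound on all partial sums inside a
   cluster limits [|A|].  Once [r = O(Delta / rho)], with
   [rho = sqrt delta * SNR * sqrt (alpha / d)], each such point has [|w_i|^2] of order
   [rho Delta^2], which is rarer than the target rate.
   As soon as the true points keep a majority in a cluster, with excess [c], each
   coordinate of its median is off by at most the noise of [c / 2] of these points, so
   [c |theta^_h - theta_h|^2 <= 2 sum_i |w_i|^2 = O(d n sigma^2)], whatever the outliers.
   With [c] of order [n alpha delta] this is the error [O(Delta / rho)], and it persists.
   Both norm bounds come from one tail estimate for sub-Gaussian vectors, in which a
   discrete mixture of exponentials replaces the Gaussian decoupling of
   [exp (|x|^2 / 2)]. *)
Require Import Defs.
From HB Require Import structures.
From mathcomp Require Import all_boot all_order all_algebra.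
From mathcomp Require Import all_classical all_reals all_analysis.
From mathcomp Require Import measurable_realfun ring lra zify.
Set Implicit Arguments. Unset Strict Implicit. Unset Printing Implicit Defensive.
Import Order.TTheory GRing.Theory Num.Theory.
Import numFieldNormedType.Exports.
Local Open Scope classical_set_scope.
Local Open Scope ring_scope.

(** * Markov's inequality and expectations of products of independent variables *)

Lemma markov_ge (R : realType) dm (Omega : measurableType dm)
    (P : probability Omega R) (f : Omega -> R) (M T : R) :
  measurable_fun setT f -> (forall om, 0 <= f om) -> 0 < T ->
  (\int[P]_om (f om)%:E <= M%:E)%E ->
  (P [set om | (T <= f om)%R] <= (M / T)%:E)%E.
Proof.
move=> mf f0 T0 fM.
have := @le_integral_comp_abse _ _ _ P _ measurableT (EFin \o f) T id
  (@measurable_id _ _ setT) (fun r r0 => r0) (fun x y _ _ xy => xy)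
  (proj2 (measurable_EFinP _ _) mf) T0.
rewrite setTI /= => h.
have -> : [set om | T <= f om] = [set x | (T%:E <= (`|f x|)%:E)%E].
  by apply/seteqP; split => om /=; rewrite lee_fin ger0_norm.
rewrite EFinM lee_pdivlMr// muleC.
apply: le_trans fM.
have -> : (\int[P]_om (f om)%:E = \int[P]_om (`|f om|)%:E)%E; last exact: h.
by apply: eq_integral => x _; rewrite ger0_norm.
Qed.

(** Distributing the product over the choice functions [u] leaves a combination of indicators of
    [\bigcap_i A i (u i)]. Each of them factorizes by [ind], and distributivity is then used
    backwards. *)
Lemma integral_prod_step (R : realType) dm (Omega : measurableType dm)
    (P : probability Omega R) (n : nat) (I : finType) (c : R)
    (A : 'I_n -> I -> set Omega) :
  0 <= c -> (forall i l, measurable (A i l)) ->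
  (forall u : 'I_n -> I, P (\bigcap_i A i (u i)) = \prod_i P (A i (u i)))%E ->
  (\int[P]_om (\prod_i \sum_l c * \1_(A i l) om)%R%:E =
    (\prod_i \sum_l c * fine (P (A i l)))%R%:E)%E.
Proof.
move=> c0 mA ind.
have mcap (u : {ffun 'I_n -> I}) : measurable (\bigcap_i A i (u i)).
  by apply: fin_bigcap_measurable => // i _; exact: mA.
under eq_integral => om _.
  rewrite bigA_distr_bigA -sumEFin.
  under eq_bigr => u _.
    rewrite (_ : (\prod_i _)%:E = ((c ^+ n)%:E * (\1_(\bigcap_i A i (u i)) om)%:E)%E);
      last first.
      rewrite -EFinM big_split /= prodr_const card_ord; congr (_ * _)%:E.
      rewrite !indicE; case: (boolP (om \in _)) => [|] h.
        apply: big1 => i _; rewrite indicE mem_set//.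
        by move: h; rewrite inE; apply.
      have [i hi] : exists i, ~ A i (u i) om.
        apply/existsNP => h'; move/negP: h; apply.
        by rewrite inE => i _; apply: h'.
      by rewrite (bigD1 i)//= indicE memNset// mul0r.
    over.
  over.
rewrite ge0_integral_sum//=; last 2 first.
- move=> u; apply/measurable_EFinP.
  by apply: measurable_funM => //; exact: measurable_indic.
- by move=> u om _; rewrite lee_fin mulr_ge0 ?exprn_ge0// indicE ler0n.
rewrite bigA_distr_bigA -sumEFin; apply: eq_bigr => u _.
rewrite ge0_integralZl_EFin//; last 2 first.
- by apply/measurable_EFinP; exact: measurable_indic.
- exact: exprn_ge0.
have -> : (\int[P]_om (\1_(\bigcap_i A i (u i)) om)%:E = \prod_i P (A i (u i)))%E.
  by rewrite integral_indic// setIT; exact: ind.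
rewrite big_split /= prodr_const card_ord EFinM.
congr (_ * _)%E; rewrite -prodEFin; apply: eq_bigr => i _.
by rewrite fineK// fin_num_measure.
Qed.

(* The step function with mesh [1/N.+1], truncated at level [N.+1]. *)
Definition staircase (R : realType) (N : nat) (x : R) : R :=
  \sum_(l < N.+1 * N.+1) N.+1%:R^-1 * (l.+1%:R / N.+1%:R <= x)%R%:R.

Lemma sum_ltn_ord (m t : nat) : (\sum_(l < m) (l < t) = minn m t)%N.
Proof.
elim: m => [|m IH]; first by rewrite big_ord0 min0n.
by rewrite big_ord_recr/= IH; lia.
Qed.

Lemma staircaseE (R : realType) (N : nat) (x : R) : 0 <= x ->
  staircase N x = (minn (N.+1 * N.+1) (Num.truncn (x * N.+1%:R)))%:R / N.+1%:R.
Proof.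
move=> x0; rewrite -sum_ltn_ord natr_sum mulr_suml; apply: eq_bigr => l _.
by rewrite mulrC truncn_ge_nat ?mulr_ge0// ler_pdivrMr.
Qed.

Lemma staircase_ge0 (R : realType) (N : nat) (x : R) : 0 <= staircase N x.
Proof. by apply: sumr_ge0 => l _; rewrite mulr_ge0 ?invr_ge0. Qed.

Lemma staircase_le (R : realType) (N : nat) (x : R) : 0 <= x -> staircase N x <= x.
Proof.
move=> x0; rewrite staircaseE// ler_pdivrMr//.
apply: (@le_trans _ _ (Num.truncn (x * N.+1%:R))%:R).
  by rewrite ler_nat geq_minr.
by rewrite truncn_le mulr_ge0.
Qed.

Lemma staircase_cvg (R : realType) (x : R) : 0 <= x ->
  staircase N x @[N --> \oo] --> x.
Proof.
move=> x0.
apply: (@squeeze_cvgr _ _ _ _ (fun N => x - harmonic N) (fun=> x)); last 2 first.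
- rewrite -[X in _ --> X]subr0; apply: cvgB; first exact: cvg_cst.
  exact: cvg_harmonic.
- exact: cvg_cst.
near=> N; rewrite staircase_le// andbT staircaseE//.
have xN : x <= N%:R.
  near: N; exists (Num.truncn x).+1 => // N /= hN.
  by apply: le_trans (ltW (truncnS_gt x)) _; rewrite ler_nat.
rewrite /harmonic /=.
(* Once [x <= N] the cap on the number of levels is inactive, and only the truncation error, below
   [1 / N.+1], remains. *)
have -> : minn (N.+1 * N.+1) (Num.truncn (x * N.+1%:R)) = Num.truncn (x * N.+1%:R).
  apply/minn_idPr; rewrite truncn_le_nat.
  apply: (@le_lt_trans _ _ (N%:R * N.+1%:R)); first by rewrite ler_pM2r ?ltr0n.
  by rewrite -natrM ltr_nat; lia.
rewrite -(mulfK (_ : N.+1%:R != 0 :> R) (x - _)) ?pnatr_eq0//.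
rewrite ler_pM2r ?invr_gt0// mulrBl mulVf ?pnatr_eq0//.
by rewrite lerBlDr natr1 ltW// truncnS_gt.
Unshelve. all: by end_near. Qed.
Lemma measurable_set_ge (R : realType) dm (T : measurableType dm) (f : T -> R) (c : R) :
  measurable_fun setT f -> measurable [set t | c <= f t].
Proof.
move=> mf; rewrite -[X in measurable X]setTI.
have -> : [set t | c <= f t] = f @^-1` `[c, +oo[%classic.
  by apply/seteqP; split => t /=; rewrite in_itv/= andbT.
by apply: mf => //; exact: measurable_itv.
Qed.

Lemma limn_einf_le (R : realType) (u : (\bar R)^nat) (M : \bar R) :
  (forall n, u n <= M)%E -> (limn_einf u <= M)%E.
Proof.
move=> uM; rewrite limn_einf_lim; apply: lime_le; first exact: is_cvg_einfs.
apply: nearW => n; apply: le_trans (uM n).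
by apply: ereal_inf_lbound; exists n => /=.
Qed.

(** Independence is assumed for superlevel sets, which are exactly the events from which staircase
    functions are built. Fatou's lemma carries the product bound from the staircases to their
    limit. *)
Lemma integral_prod_le (R : realType) dm (Omega : measurableType dm)
    (P : probability Omega R) (n : nat) (X : 'I_n -> Omega -> R) (m : 'I_n -> R) :
  (forall i, measurable_fun setT (X i)) -> (forall i om, 0 <= X i om) ->
  (forall c : 'I_n -> R, P (\bigcap_i [set om | c i <= X i om]%R) =
    \prod_i P [set om | c i <= X i om]%R)%E ->
  (forall i, \int[P]_om (X i om)%:E <= (m i)%:E)%E ->
  (\int[P]_om (\prod_i X i om)%R%:E <= (\prod_i m i)%R%:E)%E.
Proof.
move=> mX X0 ind Xm.
pose A N i (l : 'I_(N.+1 * N.+1)) := [set om | l.+1%:R / N.+1%:R <= X i om].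
have mA N i l : measurable (A N i l) by exact: measurable_set_ge.
have sE N i om : staircase N (X i om) = \sum_l N.+1%:R^-1 * \1_(A N i l) om.
  apply: eq_bigr => l _; congr (_ * _); rewrite indicE; congr (nat_of_bool _)%:R.
  by apply/idP/idP; rewrite inE.
have ms N i : measurable_fun setT (fun om => staircase N (X i om)).
  under eq_fun do rewrite sE.
  by apply: measurable_sum => l; exact: measurable_funM.
have mprod (Y : 'I_n -> Omega -> R) : (forall i, measurable_fun setT (Y i)) ->
    measurable_fun setT (fun om => \prod_i Y i om).
  by move=> mY; apply: measurable_prod => i _; exact: mY.
pose f N om := (\prod_i staircase N (X i om))%:E.
have -> : (\int[P]_om (\prod_i X i om)%R%:E = \int[P]_om limn_einf (f^~ om))%E.
  apply: eq_integral => om _; apply/esym.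
  apply: (cvg_limn_einf_sup _).1; apply: cvg_EFin; first exact: nearW.
  apply: (@cvg_big _ _ _ _ _ (@mul_continuous R)) => i _.
  exact: staircase_cvg.
apply: le_trans (fatou _ _ _ _) _ => //.
- by move=> N; apply/measurable_EFinP; apply: mprod.
- by move=> N om _; rewrite lee_fin prodr_ge0// => i _; exact: staircase_ge0.
apply: limn_einf_le => N; rewrite /f.
under eq_integral => om _ do under eq_bigr => i _ do rewrite sE.
rewrite integral_prod_step ?invr_ge0//; last first.
  by move=> u; exact: (ind (fun i => (u i).+1%:R / N.+1%:R)).
rewrite lee_fin; apply: ler_prod => i _; apply/andP; split.
  by apply: sumr_ge0 => l _; rewrite mulr_ge0 ?invr_ge0// fine_ge0.
rewrite -lee_fin; apply: le_trans (Xm i).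
apply: (@le_trans _ _ (\int[P]_om (staircase N (X i om))%:E)%E); last first.
  apply: ge0_le_integral => //.
  - by move=> om _; rewrite lee_fin staircase_ge0.
  - by apply/measurable_EFinP.
  - by apply/measurable_EFinP.
  - by move=> om _; rewrite lee_fin staircase_le.
under eq_integral => om _ do rewrite sE -sumEFin.
rewrite ge0_integral_sum//=; last first.
  by move=> l; apply/measurable_EFinP; exact: measurable_funM.
rewrite -sumEFin; apply: lee_sum => l _.
under eq_integral => om _ do rewrite EFinM.
rewrite ge0_integralZl_EFin//; last first.
  by apply/measurable_EFinP; exact: measurable_indic.
rewrite integral_indic// setIT EFinM fineK// fin_num_measure//.
Qed.

Lemma markov_count (R : realType) dm (Omega : measurableType dm)
    (P : probability Omega R) (I : finType) (A : I -> set Omega) (p : I -> R) (T : R) :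
  (forall i, measurable (A i)) -> 0 < T -> (forall i, P (A i) <= (p i)%:E)%E ->
  (P [set om | T <= \sum_i \1_(A i) om]%R <= ((\sum_i p i) / T)%:E)%E.
Proof.
move=> mA T0 Ap; apply: markov_ge => //.
- by apply: measurable_sum => i; exact: measurable_indic.
- by move=> om; apply: sumr_ge0 => i _; rewrite indicE ler0n.
under eq_integral => om _ do rewrite -sumEFin.
rewrite ge0_integral_sum//=; last first.
  by move=> l; apply/measurable_EFinP; exact: measurable_indic.
rewrite -sumEFin; apply: lee_sum => i _.
by rewrite integral_indic// setIT; exact: Ap.
Qed.

(** * Moment generating functions and the norm of a sub-Gaussian vector *)

Lemma measurable_dotv (R : realType) dm (T : measurableType dm) d
    (X : T -> vec R d) (a : vec R d) :
  (forall j, measurable_fun setT (fun t => X t j)) ->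
  measurable_fun setT (fun t => dotv a (X t)).
Proof. by move=> mX; apply: measurable_sum => j; exact: measurable_funM. Qed.

(** This brings the events of [integral_prod_le] within the scope of [mutually_independent].
    Measurability is proved on [Omega] equipped with the sigma-algebra generated by the coordinates
    of [X]. *)
Lemma gen_sigma_expR_ge (R : realType) dm (Omega : measurableType dm) d
    (X : Omega -> vec R d) (a : vec R d) (c : R) :
  gen_sigma X [set om | c <= expR (dotv a (X om))].
Proof.
rewrite /gen_sigma; set G := [set A | _].
apply: (@measurable_set_ge R _ (g_sigma_algebraType G)).
apply: measurableT_comp => //.
apply: measurable_dotv => j _ B mB.
rewrite setTI; apply: sub_sigma_algebra.
by exists j, B.
Qed.

Lemma expR_sum (R : realType) (I : Type) (r : seq I) (Q : pred I) (f : I -> R) :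
  expR (\sum_(i <- r | Q i) f i) = \prod_(i <- r | Q i) expR (f i).
Proof. by apply: (big_morph _ (@expRD R) (@expR0 R)). Qed.

Lemma mgf_sum (R : realType) dm (Omega : measurableType dm)
    (P : probability Omega R) n d (w : 'I_n -> Omega -> vec R d) (sigma : R)
    (b : 'I_n -> vec R d) :
  mutually_independent P w -> (forall i, subgaussian_zero_mean P (w i) sigma) ->
  (\int[P]_om (expR (\sum_i dotv (b i) (w i om)))%:E <=
    (expR (sigma ^+ 2 * (\sum_i sqnormv (b i)) / 2))%:E)%E.
Proof.
move=> ind sg; rewrite mulr_sumr mulr_suml expR_sum.
under eq_integral => om _ do rewrite expR_sum.
apply: (@integral_prod_le _ _ _ P _ (fun i om => expR (dotv (b i) (w i om)))).
- move=> i; apply: measurableT_comp => //.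
  by apply: measurable_dotv; case: (sg i).
- by move=> i om; exact: expR_ge0.
- move=> c.
  have := ind [set: 'I_n]%SET (fun i => [set om | c i <= expR (dotv (b i) (w i om))]).
  rewrite (eq_bigl xpredT) => [indT|i]; last by rewrite inE.
  rewrite -indT => [|i _]; last exact: gen_sigma_expR_ge.
  congr (P _); apply/seteqP; split => om /= h i; first by move=> _; exact: h.
  by move=> _; apply: h => /=; rewrite inE.
- by move=> i; have [_ [_ [_]]] := sg i; apply.
Qed.

(* Under an independent uniform sign, [zeta] makes [disc_mgf] a finite stand-in for
   the Gaussian mixture of exponentials [x |-> E exp(g x) = exp(x^2/2)]. *)
Definition zeta (R : realType) M (p : 'I_M.+1 * bool) : R := (-1) ^+ p.2 * p.1%:R.

Definition disc_mgf (R : realType) (M : nat) (x : R) : R :=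
  \sum_(p : 'I_M.+1 * bool) expR (- zeta R p ^+ 2 + zeta R p * x).

Lemma disc_mgf_ge_term (R : realType) M (l : nat) (x : R) : (l <= M)%N ->
  expR (- l%:R ^+ 2 + l%:R * `|x|) <= disc_mgf M x.
Proof.
move=> lM; rewrite /disc_mgf (bigD1 (Ordinal (lM : (l < M.+1)%N), x < 0))//=.
rewrite ler_wpDr ?sumr_ge0//.
rewrite ler_expR /zeta/= exprMn sqrr_sign mul1r.
by case: ltP => x0; rewrite ?expr1 ?expr0; [rewrite ltr0_norm|rewrite ger0_norm]; lra.
Qed.

Lemma disc_mgf_ge1 (R : realType) M (x : R) : 1 <= disc_mgf M x.
Proof.
have := disc_mgf_ge_term x (leq0n M).
by rewrite expr0n/= oppr0 mul0r addr0 expR0.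
Qed.

(** The exponent [- l ^+ 2 + l * |x|] equals [x ^+ 2 / 4 - (|x| / 2 - l) ^+ 2], so rounding
    [|x| / 2] down to an integer loses at most 1. The range condition keeps this integer within
    [M]. *)
Lemma disc_mgf_ge_sqr (R : realType) M (x : R) : `|x| <= 2 * M%:R ->
  expR (x ^+ 2 / 4 - 1) <= disc_mgf M x.
Proof.
move=> xM; pose l := Num.truncn (`|x| / 2).
have y0 : 0 <= `|x| / 2 by rewrite divr_ge0.
have lx : l%:R <= `|x| / 2 by rewrite truncn_le.
have xl : `|x| / 2 < l%:R + 1 by rewrite natr1 truncnS_gt.
apply: le_trans (disc_mgf_ge_term x (_ : (l <= M)%N)); last first.
  by rewrite -(ler_nat R); apply: le_trans lx _; rewrite ler_pdivrMr// mulrC.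
by rewrite ler_expR -[x ^+ 2]real_normK ?num_real//; nra.
Qed.

Lemma disc_mgf_ge_large (R : realType) M (x : R) : 2 * M%:R <= `|x| ->
  expR (M%:R ^+ 2) <= disc_mgf M x.
Proof.
move=> xM; apply: le_trans (disc_mgf_ge_term x (leqnn M)).
have M0 : 0 <= M%:R :> R by [].
by rewrite ler_expR; nra.
Qed.

(** Since [expR (- (1 / 2)) <= 2 / 3] and [l <= l ^+ 2], the two terms of level [l] are dominated by
    a geometric sequence. The total is at most 6, and [expR 3 >= 8]. *)
Lemma sum_expR_zeta (R : realType) M :
  \sum_(p : 'I_M.+1 * bool) expR (- zeta R p ^+ 2 / 2) <= expR 3.
Proof.
have geom N : \sum_(l < N) (2 / 3) ^+ l = 3 - 3 * (2 / 3) ^+ N :> R.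
  elim: N => [|N IH]; first by rewrite big_ord0 expr0; lra.
  by rewrite big_ord_recr/= IH exprS; lra.
have e12 : expR (- (1 / 2)) <= 2 / 3 :> R.
  have h := expR_ge1Dx (1 / 2 : R).
  by rewrite expRN -(ler_pM2l (expR_gt0 (1 / 2))) mulfV ?gt_eqF ?expR_gt0//; lra.
have e2 : 2 <= expR 1 :> R by apply: le_trans (expR_ge1Dx _); lra.
rewrite -(pair_bigA _ (fun l b => expR (- zeta R (l, b) ^+ 2 / 2)))/=.
apply: (@le_trans _ _ (\sum_(l < M.+1) 2 * (2 / 3) ^+ l)).
  apply: ler_sum => l _.
  have zE b : zeta R (l, b) ^+ 2 = (l : nat)%:R ^+ 2.
    by rewrite /zeta exprMn sqrr_sign mul1r.
  rewrite big_bool /= !zE.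
  rewrite -mulr2n mulr_natl lerMn2r; apply/orP; right.
  apply: (@le_trans _ _ (expR (- (1 / 2)) ^+ l)); last by rewrite lerXn2r ?nnegrE ?expR_ge0//; lra.
  rewrite -expRM_natl ler_expR.
  have : (l : nat)%:R <= (l : nat)%:R ^+ 2 :> R 
    by rewrite -natrX ler_nat; case: (l : nat) => // p; rewrite expnS expn1 leq_pmulr.
  by lra.
rewrite -mulr_sumr geom.
have -> : expR 3 = expR 1 * expR 1 * expR 1 :> R by rewrite -!expRD; congr expR; lra.
have e8 : 8 <= expR 1 * expR 1 * expR 1 :> R.
  have e4 : 4 <= expR 1 * expR 1 :> R by nra.
  by nra.
have : 0 <= (2 / 3) ^+ M.+1 :> R by apply: exprn_ge0; lra.
by lra.
Qed.

(** The product [f] of [disc_mgf] over the coordinates is a mixture of exponentials of linear forms,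
    so its mean is at most [expR (3 m)]; on the event it is at least [expR (t / 4 - m)]. Only the
    joint moment generating function enters, so the bound serves both for partial sums and for a
    fixed coordinate along the sample. *)
Lemma norm_tail (R : realType) dm (Omega : measurableType dm)
    (P : probability Omega R) m (X : Omega -> vec R m) (sigma t : R) :
  0 < sigma -> (forall j, measurable_fun setT (fun om => X om j)) ->
  (forall a : vec R m, \int[P]_om (expR (dotv a (X om)))%:E <=
    (expR (sigma ^+ 2 * sqnormv a / 2))%:E)%E ->
  (P [set om | t * sigma ^+ 2 <= sqnormv (X om)]%R <= (expR (4 * m%:R - t / 4))%:E)%E.
Proof.
move=> s0 mX mgf.
(* The cap is so high that a single coordinate beyond it already makes [f] exceed [expR (t / 4)]. *)
pose M := (Num.truncn `|t|).+1.
have Mt : t / 4 <= M%:R ^+ 2.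
  have h1 : `|t| < M%:R by exact: truncnS_gt.
  have h2 : 1 <= M%:R :> R by rewrite ler1n.
  have := ler_norm t; have := normr_ge0 t; nra.
pose f om := \prod_j disc_mgf M (X om j / sigma).
pose a (u : {ffun 'I_m -> 'I_M.+1 * bool}) : vec R m := fun j => zeta R (u j) / sigma.
have fE om : f om = \sum_(u : {ffun 'I_m -> 'I_M.+1 * bool})
    expR (- \sum_j zeta R (u j) ^+ 2) * expR (dotv (a u) (X om)).
  rewrite /f /disc_mgf bigA_distr_bigA; apply: eq_bigr => u _.
  rewrite -expRD -expR_sum -sumrN -big_split; congr expR; apply: eq_bigr => j _ /=.
  by rewrite /a -mulrA [_^-1 * _]mulrC.
have mterm (u : {ffun 'I_m -> 'I_M.+1 * bool}) : measurable_fun setT (fun om =>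
    expR (- \sum_j zeta R (u j) ^+ 2) * expR (dotv (a u) (X om))).
  apply: measurable_funM => //; apply: measurableT_comp => //.
  exact: measurable_dotv.
have mf : measurable_fun setT f.
  by rewrite (funext fE); exact: measurable_sum.
have f0 om : 0 <= f om.
  by apply: prodr_ge0 => j _; exact: le_trans (disc_mgf_ge1 _ _).
have Ef : (\int[P]_om (f om)%:E <= (expR (3 * m%:R))%:E)%E.
  under eq_integral => om _ do rewrite fE -sumEFin.
  rewrite ge0_integral_sum//=; last first.
    by move=> u; apply/measurable_EFinP; exact: mterm.
  apply: (@le_trans _ _ (\sum_(u : {ffun 'I_m -> 'I_M.+1 * bool})
      (\prod_j expR (- zeta R (u j) ^+ 2 / 2))%:E)%E).
    apply: lee_sum => u _.
    under eq_integral => om _ do rewrite EFinM.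
    rewrite ge0_integralZl_EFin//; last first.
      by apply/measurable_EFinP; apply: measurableT_comp => //; exact: measurable_dotv.
    apply: le_trans (lee_wpmul2l _ (mgf (a u))) _; first by rewrite lee_fin expR_ge0.
    rewrite -EFinM lee_fin -expRD -expR_sum ler_expR le_eqVlt; apply/orP; left.
    rewrite /sqnormv mulr_sumr mulr_suml -sumrN -big_split; apply/eqP.
    apply: eq_bigr => j _ /=; rewrite /a.
    by field; lra.
  rewrite sumEFin lee_fin.
  rewrite -(bigA_distr_bigA (fun (j : 'I_m) p => expR (- zeta R p ^+ 2 / 2))) prodr_const card_ord expRM_natr.
  by rewrite lerXn2r ?nnegrE ?expR_ge0 ?sum_expR_zeta// sumr_ge0// => *; exact: expR_ge0.
have := @markov_ge _ _ _ P f (expR (3 * m%:R)) (expR (t / 4 - m%:R)) mf f0 (expR_gt0 _) Ef.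
rewrite -expRN -expRD.
have -> : 3 * m%:R + - (t / 4 - m%:R) = 4 * m%:R - t / 4 by lra.
apply: le_trans; apply: le_measure; rewrite ?inE.
- by apply: measurable_set_ge; apply: measurable_sum => j; exact: measurable_funX.
- exact: measurable_set_ge.
move=> om /= tX; rewrite /f.
(* Either one coordinate is beyond the cap and suffices alone, or every coordinate is in the
   quadratic range of [disc_mgf] and the exponents add up to the squared norm. *)
have [[j hj]|hX] := pselect (exists j, 2 * M%:R <= `|X om j / sigma|).
  apply: (@le_trans _ _ (expR (M%:R ^+ 2))).
    have : 0 <= m%:R :> R by [].
    by rewrite ler_expR; lra.
  rewrite (bigD1 j)//= -[leLHS]mulr1; apply: ler_pM => //.
    exact: disc_mgf_ge_large.
  elim/big_rec : _ => // i x _ x1; rewrite -[1]mulr1 ler_pM//.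
  exact: disc_mgf_ge1.
apply: (@le_trans _ _ (expR (\sum_j ((X om j / sigma) ^+ 2 / 4 - 1)))).
  rewrite ler_expR sumrB -mulr_suml sumr_const card_ord lerD2r.
  rewrite ler_pM2r ?invr_gt0//.
  under eq_bigr do rewrite expr_div_n.
  by rewrite -mulr_suml ler_pdivlMr ?exprn_gt0.
rewrite expR_sum; apply: ler_prod => j _; rewrite expR_ge0/=.
apply: disc_mgf_ge_sqr; rewrite leNgt; apply/negP => /ltW h.
by apply: hX; exists j.
Qed.

(** * Euclidean geometry of the nearest-centre rule *)

Lemma sqnormv_ge0 (R : realType) d (a : vec R d) : 0 <= sqnormv a.
Proof. by apply: sumr_ge0 => j _; exact: sqr_ge0. Qed.

Lemma normv_ge0 (R : realType) d (a : vec R d) : 0 <= normv a.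
Proof. exact: sqrtr_ge0. Qed.

Lemma sqr_normv (R : realType) d (a : vec R d) : normv a ^+ 2 = sqnormv a.
Proof. by rewrite sqr_sqrtr// sqnormv_ge0. Qed.

Lemma dotv_sqr_le (R : realType) d (a b : vec R d) :
  dotv a b ^+ 2 <= sqnormv a * sqnormv b.
Proof.
have [b0|b0] := eqVneq (sqnormv b) 0.
  suff -> : dotv a b = 0 by rewrite expr0n/= b0 mulr0.
  apply: big1 => j _; have /eqP := b0.
  rewrite psumr_eq0 => [/allP/(_ j)|i _]; last exact: sqr_ge0.
  by rewrite mem_index_enum sqrf_eq0 => /(_ isT)/eqP ->; rewrite mulr0.
have bp : 0 < sqnormv b by rewrite lt_neqAle eq_sym b0 sqnormv_ge0.
have : 0 <= \sum_(j < d) (sqnormv b * a j - dotv a b * b j) ^+ 2.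
  by apply: sumr_ge0 => j _; exact: sqr_ge0.
have E B c : \sum_(j < d) (B * a j - c * b j) ^+ 2 =
    B ^+ 2 * sqnormv a - 2 * B * c * dotv a b + c ^+ 2 * sqnormv b.
  rewrite /sqnormv /dotv !mulr_sumr -sumrB -big_split/=.
  by apply: eq_bigr => j _; ring.
rewrite {}E.
have -> : sqnormv b ^+ 2 * sqnormv a - 2 * sqnormv b * dotv a b * dotv a b
    + dotv a b ^+ 2 * sqnormv b
    = sqnormv b * (sqnormv a * sqnormv b - dotv a b ^+ 2) by ring.
by rewrite pmulr_rge0// subr_ge0.
Qed.

Lemma dotv_abs_le (R : realType) d (a b : vec R d) :
  `|dotv a b| <= normv a * normv b.
Proof.
rewrite -(@ler_pXn2r _ 2)// ?nnegrE ?mulr_ge0 ?normv_ge0//.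
by rewrite exprMn !sqr_normv real_normK ?num_real// dotv_sqr_le.
Qed.

Lemma dotv_le (R : realType) d (a b : vec R d) : dotv a b <= normv a * normv b.
Proof. exact: le_trans (ler_norm _) (dotv_abs_le _ _). Qed.

Lemma normv_sub_le (R : realType) d (a b : vec R d) (r : R) :
  0 <= r -> normv a <= r -> normv b <= r -> normv (vsubv a b) <= 2 * r.
Proof.
move=> r0 ar br.
rewrite -(@ler_pXn2r _ 2)// ?nnegrE ?mulr_ge0 ?normv_ge0// sqr_normv.
apply: (@le_trans _ _ (2 * sqnormv a + 2 * sqnormv b)).
  rewrite /sqnormv /vsubv !mulr_sumr -big_split/=; apply: ler_sum => j _.
  by have := sqr_ge0 (a j + b j); nra.
have := normv_ge0 a; have := normv_ge0 b.
by rewrite -!sqr_normv; nra.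
Qed.

(** Expanding the squares leaves the noise-free part [|v|^2 + 2 <v, eh> + |eh|^2 - |eg|^2]. As
    [s^2 - 2 |v| s] decreases for [s <= |v|], the bounds [|eh| <= r <= |v|] give at least
    [|v|^2 - 2 |v| r + r^2 - |eg|^2], and [|eg| <= r] absorbs the last two terms without any
    second-order loss. *)
Lemma nearest_center_gap (R : realType) d (cg ch cg' ch' w : vec R d) (r : R) :
  sqnormv (vsubv (vaddv cg w) ch') <= sqnormv (vsubv (vaddv cg w) cg') ->
  normv (vsubv ch' ch) <= r -> normv (vsubv cg' cg) <= r ->
  r <= normv (vsubv ch cg) ->
  normv (vsubv ch cg) ^+ 2 - 2 * normv (vsubv ch cg) * r <=
    2 * dotv (vsubv ch cg) w
    + 2 * dotv (vsubv (vsubv ch' ch) (vsubv cg' cg)) w.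
Proof.
set v := vsubv ch cg; set eh := vsubv ch' ch; set eg := vsubv cg' cg.
move=> near ehr egr rv.
have E : sqnormv (vsubv (vaddv cg w) ch') - sqnormv (vsubv (vaddv cg w) cg') =
   sqnormv v + 2 * dotv v eh + sqnormv eh - sqnormv eg - 2 * dotv v w
   - 2 * dotv (vsubv eh eg) w.
  rewrite /sqnormv /dotv !mulr_sumr -!sumrB -!big_split/= -!sumrB.
  by apply: eq_bigr => j _; rewrite /v /eh /eg /vsubv /vaddv; ring.
have := dotv_abs_le v eh; rewrite ler_norml => /andP[cs _].
rewrite -!sqr_normv in E near.
have := normv_ge0 eh; have := normv_ge0 eg; have := normv_ge0 v.
by nra.
Qed.

(** * Robustness of the coordinatewise median *)

(** In decreasing order the median has zero-based index [p = (uphalf (size s)).-1]. The first [p.+1]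
    entries are at least the median, those from index [p] on are at most the median, and each block
    holds half of the entries. *)
Lemma med_real_count (R : realType) (s : seq R) : s != [::] ->
  (size s <= 2 * count (fun x => (med_real s <= x)%R) s)%N /\
  (size s <= 2 * count (fun x => (x <= med_real s)%R) s)%N.
Proof.
move=> s0; set ge := fun x y : R => y <= x.
have ge_tr : transitive ge by move=> y x t xy yt; exact: le_trans yt xy.
have sz : size (sort ge s) = size s by rewrite size_sort.
have ss : sorted ge (sort ge s) by apply: sort_sorted => x y; exact: le_total.
have m0 : (0 < size s)%N by case: (s) s0.
have pm : ((uphalf (size s)).-1 < size s)%N by lia.
have cnt P : count P s = count P (sort ge s).
  by apply/permP; rewrite perm_sym perm_sort.
rewrite !cnt /med_real -/ge; set p := (uphalf _).-1; set s' := sort ge s.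
have mono i j : (i <= j)%N -> (j < size s')%N -> nth 0 s' j <= nth 0 s' i.
  move=> ij js; have := sorted_leq_nth ge_tr (fun x => lexx x) 0 ss.
  by move/(_ i j (leq_ltn_trans ij js) js ij).
split.
- have h : all (fun x => nth 0 s' p <= x) (take p.+1 s').
    apply/(all_nthP 0) => i; rewrite size_takel ?sz// => ip.
    by rewrite nth_take//; apply: mono; rewrite ?sz.
  move: h; set md := nth 0 s' p; clearbody md => h.
  rewrite -[in X in (_ <= X)%N](cat_take_drop p.+1 s') count_cat.
  move: h; rewrite all_count size_takel ?sz// => /eqP ->.
  by rewrite /p; lia.
- have h : all (fun x => x <= nth 0 s' p) (drop p s').
    apply/(all_nthP 0) => i; rewrite size_drop sz => ip.
    by rewrite nth_drop; apply: mono; rewrite ?sz; lia.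
  move: h; set md := nth 0 s' p; clearbody md => h.
  rewrite -[in X in (_ <= X)%N](cat_take_drop p s') count_cat.
  move: h; rewrite all_count size_drop sz => /eqP ->.
  by rewrite /p; lia.
Qed.

(** The definitions take cardinals of classical sets; this lemma and [nhgE], [nhE], [mislE] restate
    them over finite sets. *)
Lemma nstarE n k (z : 'I_n -> 'I_k) (g : 'I_k) : nstar z g = #|[set i | z i == g]%SET|.
Proof. by apply: eq_card => i; apply/idP/idP; rewrite !inE. Qed.

Lemma sum_nstar n k (z : 'I_n -> 'I_k) : (\sum_g nstar z g = n)%N.
Proof.
rewrite -[RHS]card_ord -sum1_card (partition_big z xpredT)//=.
by apply: eq_bigr => g _; rewrite nstarE -sum1_card; apply: eq_bigl => i; rewrite inE.
Qed.

Lemma nhgE n m k (z : 'I_n -> 'I_k) (zh : 'I_n + 'I_m -> 'I_k) (h g : 'I_k) :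
  nhg z zh h g = #|[set i | (z i == h) && (zh (inl i) == g)]%SET|.
Proof. by apply: eq_card => i; apply/idP/idP; rewrite !inE. Qed.

Lemma nhE n m k (zh : 'I_n + 'I_m -> 'I_k) (h : 'I_k) :
  nh zh h = #|[set x | zh x == h]%SET|.
Proof. by apply: eq_card => i; apply/idP/idP; rewrite !inE. Qed.

Lemma mislE (R : realType) n m k (z : 'I_n -> 'I_k) (zh : 'I_n + 'I_m -> 'I_k) :
  misl R zh z = #|[set i | zh (inl i) != z i]%SET|%:R / n%:R.
Proof.
congr (_%:R / _); apply: eq_card => i; apply/idP/idP; rewrite !inE//.
Qed.

(** The correctly labelled points [B] and the points [C] satisfying [Q] both lie in the cluster [A],
    hence [|B| + |C| <= |A| + |B :&: C|], while [|A| <= 2 |C|]. The outliers count only through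
    [|A|]. *)
Lemma majority_of_true_points n m k d (R : realType) (pt : 'I_n + 'I_m -> vec R d)
    (z : 'I_n -> 'I_k) (zh : 'I_n + 'I_m -> 'I_k) (h : 'I_k) (j : 'I_d) (Q : pred R) :
  (nh zh h <= 2 * count Q [seq v j | v <- cluster_pts pt zh h])%N ->
  (2 * nhg z zh h h <=
    nh zh h + 2 * #|[set i | [&& z i == h, zh (inl i) == h & Q (pt (inl i) j)]]%SET|)%N.
Proof.
pose A : {set 'I_n + 'I_m} := [set x | zh x == h]%SET.
pose B : {set 'I_n + 'I_m} := [set inl i | i in [set i | (z i == h) && (zh (inl i) == h)]]%SET.
pose C : {set 'I_n + 'I_m} := [set x | (zh x == h) && Q (pt x j)]%SET.
have inl_inj : injective (@inl 'I_n 'I_m) by move=> ? ? [].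
have cntE : count Q [seq v j | v <- cluster_pts pt zh h] = #|C|.
  rewrite !count_map -size_filter.
  rewrite -(card_uniqP (filter_uniq _ (enum_uniq _))).
  apply: eq_card => x; rewrite mem_filter mem_enum !inE /= andbC //.
have nhgB : nhg z zh h h = #|B| by rewrite card_imset// nhgE.
have BCE : #|[set i | [&& z i == h, zh (inl i) == h & Q (pt (inl i) j)]]%SET| = #|B :&: C|.
  rewrite -(card_imset _ inl_inj); apply: eq_card => x; rewrite !inE.
  apply/imsetP/andP => [[i]|[/imsetP[i]]]; rewrite inE.
    move=> /and3P[zi zhi qi] ->; split; last by rewrite zhi.
    by apply/imsetP; exists i => //; rewrite inE zi zhi.
  by move=> /andP[zi zhi] -> /andP[_ qi]; exists i => //; rewrite inE zi zhi.
have sub : B :|: C \subset A.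
  apply/fintype.subsetP => x; rewrite !inE => /orP[/imsetP[i]|/andP[]//].
  by rewrite inE => /andP[_ ?] ->.
have := subset_leq_card sub; have := cardsUI B C.
rewrite cntE nhgB BCE nhE -/A.
move: #|B :|: C| #|B :&: C| #|B| #|C| #|A| => x1 x2 x3 x4 x5 *; lia.
Qed.

(** Half of the cluster lies beyond the median as seen from [c j]. By [majority_of_true_points],
    half of the excess of correct labels then consists of true points at least as far from [c j] as
    the median. *)
Lemma cmedian_coord_dev n m k d (R : realType) (pt : 'I_n + 'I_m -> vec R d)
    (z : 'I_n -> 'I_k) (zh : 'I_n + 'I_m -> 'I_k) (h : 'I_k) (c : vec R d) (j : 'I_d) :
  (2 * (nhg z zh h h)%:R - (nh zh h)%:R) *
    (cmedian (cluster_pts pt zh h) j - c j) ^+ 2 <=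
  2 * \sum_(i | z i == h) (pt (inl i) j - c j) ^+ 2.
Proof.
set md := cmedian _ j; set s := [seq v j | v <- cluster_pts pt zh h].
have S0 : 0 <= \sum_(i | z i == h) (pt (inl i) j - c j) ^+ 2.
  by apply: sumr_ge0 => i _; exact: sqr_ge0.
have szs : size s = nh zh h.
  by rewrite /s !size_map -cardE nhE; apply: eq_card => x; rewrite !inE.
have [Q [cQ dev]] : exists Q : pred R, (size s <= 2 * count Q s)%N /\
    forall x, Q x -> (md - c j) ^+ 2 <= (x - c j) ^+ 2.
  (* For an empty cluster the default value of the median is harmless, since no point has to be
     counted. *)
  have [->|/med_real_count[c1 c2]] := eqVneq s [::]; first by exists pred0.
  have [mc|mc] := leP (c j) md.
    by exists (fun x => md <= x); split => // x; nra.
  by exists (fun x => x <= md); split => // x; nra.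
have := @majority_of_true_points _ _ _ _ _ pt z zh h j Q.
rewrite -szs => /(_ cQ); set G := [set i | _]%SET.
rewrite -(ler_nat R) natrD !natrM => maj.
apply: (@le_trans _ _ (2 * #|G|%:R * (md - c j) ^+ 2)).
  by rewrite ler_wpM2r ?sqr_ge0//; lra.
rewrite -mulrA ler_pM2l// mulr_natl -sumr_const.
rewrite [leRHS](bigID (mem G))/= ler_wpDr//; first by apply: sumr_ge0 => i _; exact: sqr_ge0.
rewrite [leRHS](eq_bigl (mem G)) => [|i]; last by rewrite !inE; case: (z i == h).
by apply: ler_sum => i; rewrite inE => /and3P[_ _]; exact: dev.
Qed.

Lemma cmedian_dev n m k d (R : realType) (pt : 'I_n + 'I_m -> vec R d)
    (z : 'I_n -> 'I_k) (zh : 'I_n + 'I_m -> 'I_k) (h : 'I_k) (theta : 'I_k -> vec R d)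
    (w : 'I_n -> vec R d) (V : R) :
  (forall i, pt (inl i) = vaddv (theta (z i)) (w i)) ->
  (forall j, \sum_i w i j ^+ 2 <= V) ->
  (2 * (nhg z zh h h)%:R - (nh zh h)%:R) *
    sqnormv (vsubv (cmedian (cluster_pts pt zh h)) (theta h)) <= 2 * d%:R * V.
Proof.
move=> ptE wV; rewrite /sqnormv mulr_sumr.
apply: (@le_trans _ _ (\sum_(j < d) 2 * V)); last first.
  by rewrite sumr_const card_ord -[_ *+ d]mulr_natr mulrAC.
apply: ler_sum => j _; apply: le_trans (cmedian_coord_dev _ _ _ _ _ _) _.
rewrite ler_pM2l//; apply: le_trans (wV j).
rewrite [leRHS](bigID (fun i => z i == h))/= ler_wpDr//.
  by apply: sumr_ge0 => i _; exact: sqr_ge0.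
by apply: ler_sum => i /eqP <-; rewrite ptE /vaddv addrAC subrr add0r.
Qed.

(** * Deterministic analysis of one relabelling step *)

Lemma fmin_le (R : realType) (I : finType) (Q : pred I) (f : I -> R) (i : I) :
  Q i -> fmin Q f <= f i.
Proof.
move=> Qi; rewrite /fmin; case: pickP => [i0 _|/(_ i)]; last by rewrite Qi.
exact: bigmin_le_cond.
Qed.

Lemma le_fmax (R : realType) (I : finType) (Q : pred I) (f : I -> R) (i : I) :
  Q i -> f i <= fmax Q f.
Proof.
move=> Qi; rewrite /fmax; case: pickP => [i0 _|/(_ i)]; last by rewrite Qi.
exact: le_bigmax_cond.
Qed.

Lemma card_bigcup_le (I T : finType) (F : I -> {set T}) :
  (#|(\bigcup_i F i)%SET| <= \sum_i #|F i|)%N.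
Proof.
elim/big_rec2 : _ => [|i s A _ IH]; first by rewrite cards0.
by apply: leq_trans (leq_card_setU _ _).1 _; rewrite leq_add2l.
Qed.

Lemma card_imset_le (I T : finType) (f : I -> T) (A : {set I}) (B : {set T}) :
  injective f -> (forall i, i \in A -> f i \in B) -> (#|A| <= #|B|)%N.
Proof.
move=> fi fAB; rewrite -(card_imset _ fi); apply: subset_leq_card.
by apply/fintype.subsetP => _ /imsetP[i iA ->]; exact: fAB.
Qed.

Lemma dotv_sumr (R : realType) d (I : finType) (A : {set I}) (a : vec R d)
    (w : I -> vec R d) :
  dotv a (fun j => \sum_(i in A) w i j) = \sum_(i in A) dotv a (w i).
Proof.
rewrite /dotv exchange_big /=; apply: eq_bigr => j _.
by rewrite mulr_sumr.
Qed.

Lemma mislabeled_split (R : realType) n m k d (z : 'I_n -> 'I_k)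
    (pt : 'I_n + 'I_m -> vec R d) (theta th : 'I_k -> vec R d) (w : 'I_n -> vec R d)
    (zh : 'I_n + 'I_m -> 'I_k) (D r : R) (i : 'I_n) :
  (forall i, pt (inl i) = vaddv (theta (z i)) (w i)) ->
  (forall x h, sqnormv (vsubv (pt x) (th (zh x))) <= sqnormv (vsubv (pt x) (th h))) ->
  (forall h, normv (vsubv (th h) (theta h)) <= r) ->
  (forall g h, g != h -> D <= normv (vsubv (theta g) (theta h))) ->
  0 <= r -> r <= D -> zh (inl i) != z i ->
  let v := vsubv (theta (zh (inl i))) (theta (z i)) in
  let u := vsubv (vsubv (th (zh (inl i))) (theta (zh (inl i))))
                 (vsubv (th (z i)) (theta (z i))) in
  [/\ D <= normv v, normv u <= 2 * r &
    normv v ^+ 2 - 2 * normv v * r <= 2 * dotv v (w i) + 2 * dotv u (w i)].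
Proof.
move=> ptE lab thr sep r0 rD ne v u.
have Dv : D <= normv v by exact: sep.
split => //; first exact: normv_sub_le.
apply: nearest_center_gap => //; last exact: le_trans Dv.
by rewrite -ptE; exact: lab.
Qed.

Section one_step.
Context (R : realType) (n m k d : nat) (z : 'I_n -> 'I_k)
  (pt : 'I_n + 'I_m -> vec R d) (theta th : 'I_k -> vec R d) (w : 'I_n -> vec R d)
  (zh : 'I_n + 'I_m -> 'I_k) (sigma snr D : R).
Hypothesis ptE : forall i, pt (inl i) = vaddv (theta (z i)) (w i).
Hypothesis lab : forall x h,
  sqnormv (vsubv (pt x) (th (zh x))) <= sqnormv (vsubv (pt x) (th h)).
Hypothesis sep : forall g h, g != h -> D <= normv (vsubv (theta g) (theta h)).
Hypothesis s0 : 0 < sigma.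
Hypothesis n0 : 0 < snr.
Hypothesis DE : D = 2 * sigma * snr.

(** These pairs of a point and a wrong centre involve the true centres only, no estimate. One event
    therefore controls them at all steps. *)
Definition crossing (t : R) : {set 'I_n * 'I_k} :=
  [set p | (p.2 != z p.1) &&
    (t * normv (vsubv (theta p.2) (theta (z p.1))) ^+ 2 <=
      dotv (vsubv (theta p.2) (theta (z p.1))) (w p.1))]%SET.

(* With centroid error [5 D / rho], the random direction contributes at most
   [20 D / rho * normv (w i)] to the margin, so beating the slack of order
   [D ^+ 2 / sqrt rho] forces [normv (w i) >= D * sqrt rho]. *)
Lemma misl_le_crossing (rho : R) : 1 <= rho ->  10 / rho <= 1 ->
  (forall h, normv (vsubv (th h) (theta h)) <= 5 * D / rho) ->
  (#|[set i | zh (inl i) != z i]%SET| <=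
    #|crossing ((1 - 30 / Num.sqrt rho) / 2)| +
    #|[set i | (D ^+ 2 * rho <= sqnormv (w i))%R]%SET|)%N.
Proof.
move=> rho1 rho10 thr.
have D0 : 0 < D by rewrite DE !mulr_gt0.
have rho0 : 0 < rho by lra.
set c := crossing _; pose B := [set i | (D ^+ 2 * rho <= sqnormv (w i))%R]%SET.
rewrite -/B.
pose X := [set i | (i, zh (inl i)) \in c]%SET.
apply: (@leq_trans #|X :|: B|); last first.
  apply: leq_trans (leq_card_setU _ _).1 _; rewrite leq_add2r.
  by apply: (@card_imset_le _ _ (fun i => (i, zh (inl i)))) => [i j []//|i]; rewrite inE.
apply: subset_leq_card; apply/fintype.subsetP => i; rewrite !inE /= => ne; rewrite ne /=.
have r0 : 0 <= 5 * D / rho by rewrite ltW// divr_gt0// mulr_gt0.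
have rD : 5 * D / rho <= D by rewrite ler_pdivrMr//; move: rho10; rewrite ler_pdivrMr//; nra.
have [] := mislabeled_split ptE lab thr sep r0 rD ne.
set v := vsubv _ _; set u := vsubv _ _; pose q : R := Num.sqrt rho; rewrite -/q.
have q1 : 1 <= q.
  by rewrite /q -[leLHS](@sqrtr1 R); apply: ler_wsqrtr.
have qq : q ^+ 2 = rho by rewrite sqr_sqrtr// ltW.
move=> Dv ur gap; case: leP => //= nc.
have q0 : 0 < q by lra.
have qn0 : q != 0 by rewrite gt_eqF.
(* Of the slack [30 / q] left by a point that does not cross, [10 / q] pays for the centroid errors
   along [v], and [20 / q] must come from the direction [u]. *)
have key : 20 / q * D ^+ 2 <= 2 * dotv u (w i).
  have h1 : 5 * D / rho <= 5 * normv v / q.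
    rewrite -qq expr2 invfM !mulrA ler_pM2r ?invr_gt0// ler_pdivrMr//.
    have := normv_ge0 v; nra.
  have h2 : 20 / q * D ^+ 2 <= 20 / q * normv v ^+ 2.
    by rewrite ler_pM2l ?divr_gt0// lerXn2r ?nnegrE ?normv_ge0// ltW.
  have h3 : 2 * normv v * (5 * D / rho) <= 10 / q * normv v ^+ 2.
    apply: (@le_trans _ _ (2 * normv v * (5 * normv v / q))).
      by rewrite ler_wpM2l// mulr_ge0// normv_ge0.
    by rewrite le_eqVlt; apply/orP; left; apply/eqP; ring.
  have h4 : (1 - 30 / q) / 2 * normv v ^+ 2 =
    normv v ^+ 2 / 2 - 15 / q * normv v ^+ 2 by field.
  have h5 : 30 / q * normv v ^+ 2 = 2 * (15 / q * normv v ^+ 2) by ring.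
  have h6 : 30 / q * normv v ^+ 2 = 20 / q * normv v ^+ 2 + 10 / q * normv v ^+ 2 by ring.
  lra.
have wge : D * q <= normv (w i).
  have := dotv_le u (w i).
  have h7 : normv u * normv (w i) <= 10 * D / rho * normv (w i).
    by rewrite ler_wpM2r ?normv_ge0//; apply: le_trans ur _; rewrite mulrA mulrA -natrM.
  move=> h8; have h9 : 20 / q * D ^+ 2 <= 20 * D / rho * normv (w i) by lra.
  move: h9; rewrite -qq expr2 [q ^+ 2]expr2 invfM => h9.
  have : 20 / q * D * (D * q) <= 20 / q * D * normv (w i).
    have -> : 20 / q * D * (D * q) = 20 / q * (D * D) * q by ring.
    have -> : 20 / q * D * normv (w i) = 20 * D * (q^-1 * q^-1) * normv (w i) * q.
      by field.
    by rewrite ler_pM2r.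
  by rewrite ler_pM2l// mulr_gt0// divr_gt0.
rewrite -sqr_normv -qq -exprMn lerXn2r ?nnegrE ?normv_ge0// mulr_ge0// ltW//.
Qed.

(* The points relabelled from [g] to [g'] because of the random direction [u] form a set
   whose noises all correlate with [u]; their sum is then long, and concentration
   uniform over subsets of a cluster bounds the size of that set. *)
Lemma step_counts (eps K : R) (h : 'I_k) : 0 < eps -> eps <= 1 / 2 -> 0 <= K ->
  (forall A : {set 'I_n}, forall g, (forall i, i \in A -> z i = g) ->
    sqnormv (fun j => \sum_(i in A) w i j) <=
      K * sigma ^+ 2 * #|A|%:R * ((nstar z g)%:R + d%:R)) ->
  (forall h, normv (vsubv (th h) (theta h)) <= (1 / 2 - eps) * D) ->
  (nstar z h)%:R + (nh zh h)%:R <=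
    2 * (nhg z zh h h)%:R + m%:R + 2 * #|crossing (eps / 2)|%:R +
    K * (k%:R * (nstar z h)%:R + n%:R + 2 * k%:R * d%:R) / (eps ^+ 2 * snr ^+ 2).
Proof.
move=> e0 e12 K0 conc thr.
have D0 : 0 < D by rewrite DE !mulr_gt0.
have q0 : 0 < eps ^+ 2 * snr ^+ 2 by rewrite mulr_gt0 ?exprn_gt0.
pose e g := vsubv (th g) (theta g).
pose S g h := [set i | [&& z i == g, zh (inl i) == h &
  eps * D ^+ 2 / 2 <= dotv (vsubv (e h) (e g)) (w i)]]%SET.
pose c := crossing (eps / 2).
pose X := [set i | (i, zh (inl i)) \in c]%SET.
pose out := [set i | (z i == h) && (zh (inl i) != h)]%SET.
pose inc := [set i | (z i != h) && (zh (inl i) == h)]%SET.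
have r0 : 0 <= (1 / 2 - eps) * D by rewrite mulr_ge0 ?(ltW D0)// subr_ge0.
have rD : (1 / 2 - eps) * D <= D by nra.
have Xc : (#|X| <= #|c|)%N.
  by apply: (@card_imset_le _ _ (fun i => (i, zh (inl i)))) => [i j []//|i]; rewrite inE.
(* The centroid errors leave a margin of at least [2 eps |v|^2]. A point that does not cross covers
   less than half of it along [v], so [u] must supply the rest. *)
have dich i : zh (inl i) != z i -> (i \in X) || (i \in S (z i) (zh (inl i))).
  move=> ne; rewrite !inE /= ne !eqxx /=.
  have [] := mislabeled_split ptE lab thr sep r0 rD ne.
  rewrite -/(e _) -/(e _); set v := vsubv _ _; set u := vsubv _ _ => Dv _ gap.
  case: leP => //= nc.
  have h1 : 2 * normv v * ((1 / 2 - eps) * D) <= 2 * normv v * ((1 / 2 - eps) * normv v).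
    rewrite ler_wpM2l ?mulr_ge0 ?normv_ge0// ler_wpM2l//; lra.
  have h2 : eps * D ^+ 2 <= eps * normv v ^+ 2.
    by rewrite ler_pM2l// lerXn2r ?nnegrE ?normv_ge0// ltW.
  lra.
have Sle g g' : #|S g g'|%:R <= K * ((nstar z g)%:R + d%:R) / (eps ^+ 2 * snr ^+ 2).
  rewrite ler_pdivlMr//.
  have [->|Sp] := posnP #|S g g'|; first by rewrite mul0r mulr_ge0// addr_ge0.
  have Sp' : 0 < #|S g g'|%:R :> R by rewrite ltr0n.
  set s := #|S g g'|%:R in Sp' *.
  have zS i : i \in S g g' -> z i = g by rewrite inE => /and3P[/eqP].
  have := conc (S g g') g zS; set W := fun j => _; rewrite -/s => cW.
  have lower : s * (eps * D ^+ 2 / 2) <= dotv (vsubv (e g') (e g)) W.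
    have -> : s * (eps * D ^+ 2 / 2) = \sum_(i in S g g') (eps * D ^+ 2 / 2).
      by rewrite sumr_const -[RHS]mulr_natl.
    rewrite dotv_sumr; apply: ler_sum => i.
    by rewrite inE => /and3P[].
  have uD : normv (vsubv (e g') (e g)) <= D.
    apply: le_trans (normv_sub_le r0 (thr g') (thr g)) _; nra.
  have upper : dotv (vsubv (e g') (e g)) W <= D * normv W.
    by apply: le_trans (dotv_le _ _) _; rewrite ler_wpM2r ?normv_ge0.
  have Wge : s * (eps * D / 2) <= normv W.
    by rewrite -(ler_pM2l D0); apply: le_trans _ upper; apply: le_trans _ lower; nra.
  have : (s * (eps * D / 2)) ^+ 2 <= sqnormv W.
    rewrite -sqr_normv lerXn2r ?nnegrE ?normv_ge0// mulr_ge0// ?ltW//.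
    by rewrite divr_gt0// mulr_gt0.
  move=> /le_trans/(_ cW).
  have -> : (s * (eps * D / 2)) ^+ 2 =
    s * sigma ^+ 2 * (s * (eps ^+ 2 * snr ^+ 2)) by rewrite DE; field.
  have -> : K * sigma ^+ 2 * s * ((nstar z g)%:R + d%:R) =
    s * sigma ^+ 2 * (K * ((nstar z g)%:R + d%:R)) by ring.
  by rewrite ler_pM2l// mulr_gt0// exprn_gt0.
have outle : (#|out| <= #|c| + \sum_g #|S h g|)%N.
  apply: (@leq_trans #|(X :|: \bigcup_g S h g)%SET|).
    apply: subset_leq_card; apply/fintype.subsetP => i; rewrite inE => /andP[/eqP zi ne].
    have := dich i; rewrite zi => /(_ ne) /orP[iX|iS]; rewrite inE ?iX//.
    by apply/orP; right; apply/bigcupP; exists (zh (inl i)).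
  by apply: leq_trans (leq_card_setU _ _).1 _; rewrite leq_add// card_bigcup_le.
have incle : (#|inc| <= #|c| + \sum_g #|S g h|)%N.
  apply: (@leq_trans #|(X :|: \bigcup_g S g h)%SET|).
    apply: subset_leq_card; apply/fintype.subsetP => i; rewrite inE => /andP[ne /eqP zi].
    have := dich i; rewrite zi eq_sym => /(_ ne) /orP[iX|iS]; rewrite inE ?iX//.
    by apply/orP; right; apply/bigcupP; exists (z i).
  by apply: leq_trans (leq_card_setU _ _).1 _; rewrite leq_add// card_bigcup_le.
have nstar_h : nstar z h = (nhg z zh h h + #|out|)%N.
  rewrite nstarE nhgE -cardsUI (_ : _ :&: _ = finset.set0) ?cards0 ?addn0.
    apply: eq_card => i; rewrite !inE; case: (z i == h) => //=.
    by case: (_ == h).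
  apply/setP => i; rewrite !inE; case: (z i == h) => //=.
  by case: (_ == h).
(* In the worst case all [m] outliers carry the label [h]. *)
have nh_h : (nh zh h <= nhg z zh h h + #|inc| + m)%N.
  rewrite nhE.
  pose U : {set 'I_n + 'I_m} := [set inl i | i in [set i | zh (inl i) == h]]%SET.
  pose V : {set 'I_n + 'I_m} := [set inr j | j in [set: 'I_m]]%SET.
  apply: (@leq_trans #|U :|: V|).
    apply: subset_leq_card; apply/fintype.subsetP => -[i|j]; rewrite !inE => hx.
      by apply/orP; left; apply/imsetP; exists i; rewrite ?inE.
    by apply/orP; right; apply/imsetP; exists j; rewrite ?inE.
  apply: leq_trans (leq_card_setU _ _).1 _.
  rewrite !card_imset ?cardsT ?card_ord ?leq_add2r; try by move=> ? ? [].
  rewrite nhgE -cardsUI; apply: leq_trans (leq_addr _ _).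
  apply: subset_leq_card; apply/fintype.subsetP => i; rewrite !inE => ->.
  by rewrite !andbT orbN.
have outR : #|out|%:R <= #|c|%:R +
    K * (k%:R * (nstar z h)%:R + k%:R * d%:R) / (eps ^+ 2 * snr ^+ 2).
  apply: (@le_trans _ _ (#|c|%:R + \sum_g #|S h g|%:R)).
    by rewrite -natr_sum -natrD ler_nat.
  rewrite lerD2l; apply: (@le_trans _ _ (\sum_(g < k) K * ((nstar z h)%:R + d%:R) / (eps ^+ 2 * snr ^+ 2))).
    by apply: ler_sum.
  rewrite sumr_const card_ord -[_ *+ k]mulr_natr le_eqVlt; apply/orP; left; apply/eqP.
  ring.
have incR : #|inc|%:R <= #|c|%:R +
    K * (n%:R + k%:R * d%:R) / (eps ^+ 2 * snr ^+ 2).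
  apply: (@le_trans _ _ (#|c|%:R + \sum_g #|S g h|%:R)).
    by rewrite -natr_sum -natrD ler_nat.
  rewrite lerD2l; apply: (@le_trans _ _ (\sum_(g < k) K * ((nstar z g)%:R + d%:R) / (eps ^+ 2 * snr ^+ 2))).
    by apply: ler_sum.
  rewrite -mulr_suml -mulr_sumr big_split /= -natr_sum sum_nstar sumr_const card_ord.
  by rewrite -[_ *+ k]mulr_natl.
have E : K * (k%:R * (nstar z h)%:R + n%:R + 2 * k%:R * d%:R) / (eps ^+ 2 * snr ^+ 2) =
  K * (k%:R * (nstar z h)%:R + k%:R * d%:R) / (eps ^+ 2 * snr ^+ 2) +
  K * (n%:R + k%:R * d%:R) / (eps ^+ 2 * snr ^+ 2) by ring.
rewrite E.
have h1 : (nstar z h)%:R = (nhg z zh h h)%:R + #|out|%:R :> R by rewrite nstar_h natrD.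
have h2 : (nh zh h)%:R <= (nhg z zh h h)%:R + #|inc|%:R + m%:R :> R.
  by rewrite -!natrD ler_nat.
rewrite -/c; lra.
Qed.

End one_step.

(** * Tail events of the noise *)

(** With [T = 1] this is the union bound; with larger [T] it bounds the number of offending
    points. *)
Lemma markov_card (R : realType) dm (Omega : measurableType dm)
    (P : probability Omega R) (I : finType) (a : I -> Omega -> bool) (p : I -> R) (T : R) :
  (forall i, measurable [set om | a i om]) -> 0 < T ->
  (forall i, P [set om | a i om] <= (p i)%:E)%E ->
  measurable [set om | T <= #|[set i | a i om]%SET|%:R] /\
  (P [set om | T <= #|[set i | a i om]%SET|%:R]%R <= ((\sum_i p i) / T)%:E)%E.
Proof.
move=> ma T0 ap.
have cE om : #|[set i | a i om]%SET|%:R = \sum_i \1_[set om | a i om] om :> R.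
  rewrite -sum1_card natr_sum big_mkcond; apply: eq_bigr => i _.
  rewrite inE indicE; case: (boolP (a i om)) => h; first by rewrite mem_set.
  by rewrite memNset//; exact/negP.
have E : [set om | T <= #|[set i | a i om]%SET|%:R] =
    [set om | T <= \sum_i \1_[set om | a i om] om].
  by apply/seteqP; split => om /=; rewrite cE.
rewrite E; split; last exact: markov_count.
by apply: measurable_set_ge; apply: measurable_sum => i; exact: measurable_indic.
Qed.

Lemma dotvZl (R : realType) d (c : R) (a b : vec R d) :
  dotv (fun j => c * a j) b = c * dotv a b.
Proof. by rewrite /dotv mulr_sumr; apply: eq_bigr => j _; rewrite mulrA. Qed.

Lemma sqnormvZ (R : realType) d (c : R) (a : vec R d) :
  sqnormv (fun j => c * a j) = c ^+ 2 * sqnormv a.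
Proof. by rewrite /sqnormv mulr_sumr; apply: eq_bigr => j _; rewrite exprMn. Qed.

Lemma dotv_tail (R : realType) dm (Omega : measurableType dm)
    (P : probability Omega R) d (X : Omega -> vec R d) (v : vec R d) (sigma t : R) :
  0 < sigma -> 0 <= t -> subgaussian_zero_mean P X sigma ->
  (P [set om | t * sqnormv v <= dotv v (X om)]%R <=
    (expR (- (t ^+ 2 * sqnormv v / (2 * sigma ^+ 2))))%:E)%E.
Proof.
move=> s0 t0 [mX [_ [_ mgf]]].
have sn0 : sigma != 0 by rewrite gt_eqF.
(* This slope minimizes the Chernoff exponent [sigma^2 l^2 |v|^2 / 2 - l t |v|^2]. *)
pose l := t / sigma ^+ 2.
have l0 : 0 <= l by rewrite divr_ge0 ?exprn_ge0// ltW.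
pose f om := expR (dotv (fun j => l * v j) (X om)).
have mf : measurable_fun setT f.
  by apply: measurableT_comp => //; exact: measurable_dotv.
have := @markov_ge _ _ _ P f _ (expR (l * (t * sqnormv v))) mf
  (fun=> expR_ge0 _) (expR_gt0 _) (mgf _).
rewrite -expRN -expRD sqnormvZ.
have -> : sigma ^+ 2 * (l ^+ 2 * sqnormv v) / 2 + - (l * (t * sqnormv v)) =
    - (t ^+ 2 * sqnormv v / (2 * sigma ^+ 2)) by rewrite /l; field.
apply: le_trans; apply: le_measure; rewrite ?inE.
- by apply: measurable_set_ge; exact: measurable_dotv.
- exact: measurable_set_ge.
- by move=> om /= h; rewrite /f ler_expR dotvZl ler_wpM2l.
Qed.

Section model.
Context (R : realType) (n k d : nat) (z : 'I_n -> 'I_k) (theta : 'I_k -> vec R d)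
  (dm : measure_display) (Omega : measurableType dm) (P : probability Omega R)
  (w : 'I_n -> Omega -> vec R d) (sigma : R).
Hypothesis s0 : 0 < sigma.
Hypothesis wind : mutually_independent P w.
Hypothesis wsub : forall i, subgaussian_zero_mean P (w i) sigma.

Let mw i j : measurable_fun setT (fun om => w i om j).
Proof. by case: (wsub i). Qed.

(** Giving weight [a] to the points of [A] and 0 to the others shows that the partial sum is
    sub-Gaussian with parameter [sigma * sqrt |A|], as [norm_tail] requires. *)
Lemma mgf_partial_sum (A : {set 'I_n}) (a : vec R d) :
  (\int[P]_om (expR (dotv a (fun j => \sum_(i in A) w i om j)))%:E <=
    (expR ((sigma * Num.sqrt #|A|%:R) ^+ 2 * sqnormv a / 2))%:E)%E.
Proof.
pose b i : vec R d := fun j => (i \in A)%:R * a j.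
have := mgf_sum b wind wsub.
have -> : \sum_i sqnormv (b i) = #|A|%:R * sqnormv a.
  rewrite -sum1_card natr_sum mulr_suml [RHS]big_mkcond; apply: eq_bigr => i _.
  by rewrite sqnormvZ; case: (i \in A); rewrite ?expr1n ?expr0n/= ?mul1r ?mul0r.
rewrite exprMn sqr_sqrtr// mulrA.
apply: le_trans; rewrite le_eqVlt; apply/orP; left; apply/eqP.
apply: eq_integral => om _; congr (expR _)%:E.
rewrite dotv_sumr big_mkcond; apply: eq_bigr => i _.
by rewrite dotvZl; case: (i \in A); rewrite ?mul1r ?mul0r.
Qed.

(** Here the roles are exchanged: the [j]-th coordinates of the sample form one sub-Gaussian vector
    of dimension [n]. *)
Lemma mgf_coordinate (j : 'I_d) (a : vec R n) :
  (\int[P]_om (expR (dotv a (fun i => w i om j)))%:E <=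
    (expR (sigma ^+ 2 * sqnormv a / 2))%:E)%E.
Proof.
pose b i : vec R d := fun l => a i * (l == j)%:R.
have := mgf_sum b wind wsub.
have dE i (x : vec R d) : dotv (b i) x = a i * x j.
  rewrite /dotv (bigD1 j)//= /b eqxx mulr1 big1 ?addr0// => l /negPf ->.
  by rewrite mulr0 mul0r.
have -> : \sum_i sqnormv (b i) = sqnormv a.
  apply: eq_bigr => i _; rewrite /sqnormv (bigD1 j)//= /b eqxx mulr1 big1 ?addr0//.
  by move=> l /negPf ->; rewrite mulr0 expr0n.
apply: le_trans; rewrite le_eqVlt; apply/orP; left; apply/eqP.
by apply: eq_integral => om _; congr (expR _)%:E; apply: eq_bigr => i _; rewrite dE.
Qed.

(** [norm_tail] in dimension [n] with [t = 20 n] gives the exponent [4 n - 5 n = - n]; a union bound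
    over the coordinates yields the factor [d]. *)
Lemma coordinate_energy_event : exists B : set Omega, [/\ measurable B,
  (P B <= (d%:R * expR (- n%:R))%:E)%E &
  forall om, ~ B om -> forall j, \sum_i w i om j ^+ 2 <= 20 * n%:R * sigma ^+ 2].
Proof.
pose a (j : 'I_d) om := 20 * n%:R * sigma ^+ 2 <= sqnormv (fun i => w i om j).
have ma j : measurable [set om | a j om].
  by apply: measurable_set_ge; apply: measurable_sum => i; exact: measurable_funX.
have pa j : (P [set om | a j om] <= (expR (- n%:R))%:E)%E.
  apply: le_trans (@norm_tail _ _ _ P n (fun om i => w i om j) sigma (20 * n%:R) s0 _ _) _.
  - by move=> i; exact: mw.
  - exact: mgf_coordinate.
  - by rewrite lee_fin ler_expR; lra.
have [mB PB] := markov_card ma ltr01 pa.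
exists [set om | 1 <= #|[set j | a j om]%SET|%:R :> R]; split => //.
  by apply: le_trans PB _; rewrite divr1 sumr_const card_ord -[_ *+ d]mulr_natl.
move=> om /= nB j; rewrite leNgt; apply/negP => h; apply: nB.
rewrite ler1n; apply/card_gt0P; exists j; rewrite inE /a; exact: ltW.
Qed.

(** For one subset of cluster [g] the tail exponent is at most [- 5 n_g]. The [2 ^ n_g] subsets of
    the cluster cost at most [expR n_g], and [ln n <= n_g] turns the remaining [expR (- 4 n_g)] into
    [n ^- 4]. *)
Lemma partial_sums_event : (0 < n)%N -> (forall g, ln n%:R <= (nstar z g)%:R :> R) ->
  exists B : set Omega, [/\ measurable B,
  (P B <= (k%:R * n%:R ^- 4)%:E)%E &
  forall om, ~ B om -> forall (A : {set 'I_n}) g, (forall i, i \in A -> z i = g) ->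
    sqnormv (fun j => \sum_(i in A) w i om j) <=
      20 * sigma ^+ 2 * #|A|%:R * ((nstar z g)%:R + d%:R)].
Proof.
move=> n0 lnn.
pose T g := [set i | z i == g]%SET.
(* The empty set is excluded because the parameter [sigma * sqrt |A|] has to be positive. *)
pose a (q : 'I_k * {set 'I_n}) om := [&& q.2 \subset T q.1, q.2 != finset.set0 &
  20 * ((nstar z q.1)%:R + d%:R) * (sigma * Num.sqrt #|q.2|%:R) ^+ 2 <=
  sqnormv (fun j => \sum_(i in q.2) w i om j)].
have mS (A : {set 'I_n}) j : measurable_fun setT (fun om => \sum_(i in A) w i om j).
  under eq_fun do rewrite big_mkcond.
  by apply: measurable_sum => i; case: (i \in A).
have ma q : measurable [set om | a q om].
  rewrite /a; case: (_ \subset _) => /=; last first.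
    by rewrite (_ : [set _ | _] = set0)//; apply/seteqP; split.
  case: (_ != _) => /=; last first.
    by rewrite (_ : [set _ | _] = set0)//; apply/seteqP; split.
  apply: measurable_set_ge; apply: measurable_sum => j; exact: measurable_funX.
pose p (q : 'I_k * {set 'I_n}) : R :=
  if q.2 \subset T q.1 then expR (- (5 * (nstar z q.1)%:R)) else 0.
have pa q : (P [set om | a q om] <= (p q)%:E)%E.
  rewrite /a /p; case: (boolP (q.2 \subset _)) => /= _; last first.
    by rewrite (_ : [set _ | _] = set0) ?measure0//; apply/seteqP; split.
  case: (boolP (q.2 != _)) => /= [q0|_]; last first.
    by rewrite (_ : [set _ | _] = set0) ?measure0 ?lee_fin ?expR_ge0//; apply/seteqP; split.
  have sA0 : 0 < sigma * Num.sqrt #|q.2|%:R.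
    by rewrite mulr_gt0// sqrtr_gt0 ltr0n card_gt0.
  apply: le_trans (@norm_tail _ _ _ P d (fun om j => \sum_(i in q.2) w i om j)
    _ (20 * ((nstar z q.1)%:R + d%:R)) sA0 _ _) _.
  - by move=> j; exact: mS.
  - exact: mgf_partial_sum.
  - rewrite lee_fin ler_expR.
    have : 0 <= d%:R :> R by [].
    by lra.
have [mB PB] := markov_card ma ltr01 pa.
exists [set om | 1 <= #|[set j | a j om]%SET|%:R :> R]; split => //.
  apply: le_trans PB _; rewrite divr1 lee_fin /p.
  rewrite -(pair_bigA _ (fun g (A : {set 'I_n}) => if A \subset T g then expR (- (5 * (nstar z g)%:R)) else 0))/=.
  have -> : k%:R / n%:R ^+ 4 = \sum_(g < k) n%:R ^- 4 :> R.
    by rewrite sumr_const card_ord -[RHS]mulr_natl.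
  apply: ler_sum => g _.
  rewrite -big_mkcond sumr_const.
  have -> : #|[pred A : {set 'I_n} | A \subset T g]| = (2 ^ nstar z g)%N.
    by rewrite nstarE -card_powerset; apply: eq_card => A; rewrite !inE.
  have e2 : 2 <= expR 1 :> R by apply: le_trans (expR_ge1Dx _); lra.
  apply: (@le_trans _ _ (expR (- (4 * (nstar z g)%:R)))).
    rewrite -[_ *+ (2 ^ _)]mulr_natl natrX.
    apply: (@le_trans _ _ (expR 1 ^+ nstar z g * expR (- (5 * (nstar z g)%:R)))).
      by rewrite ler_wpM2r ?expR_ge0// lerXn2r ?nnegrE ?expR_ge0.
    by rewrite -expRM_natl -expRD ler_expR; lra.
  rewrite expRN lef_pV2 ?posrE ?expR_gt0 ?exprn_gt0 ?ltr0n//.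
  rewrite -[X in X ^+ 4](@lnK R) ?posrE ?ltr0n// -expRM_natl ler_expR.
  by rewrite ler_pM2l.
move=> om /= nB A g zA.
have [->|A0] := eqVneq A finset.set0.
  rewrite cards0 mulr0 mul0r /sqnormv big1// => j _.
  by rewrite big_set0 expr0n.
rewrite leNgt; apply/negP => h; apply: nB.
rewrite ler1n; apply/card_gt0P; exists (g, A); rewrite inE /a /= A0.
apply/andP; split.
  by apply/fintype.subsetP => i /zA; rewrite inE => ->.
rewrite exprMn sqr_sqrtr//; apply: ltW; apply: le_lt_trans h.
by rewrite le_eqVlt; apply/orP; left; apply/eqP; ring.
Qed.

(** As [|v| >= 2 sigma snr], each pair crosses with probability at most [expR (- 2 t^2 snr^2)], and
    Markov's inequality is applied to the number of pairs. For [t] near [1 / 2] the exponent is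
    close to the target [snr^2 / 2]. *)
Lemma crossing_event (snr t T : R) : 0 <= snr -> 0 <= t -> 0 < T ->
  (forall g h, g != h -> 2 * sigma * snr <= normv (vsubv (theta g) (theta h))) ->
  exists B : set Omega, [/\ measurable B,
  (P B <= ((n * k)%:R * expR (- (2 * t ^+ 2 * snr ^+ 2)) / T)%:E)%E &
  forall om, ~ B om -> #|crossing z theta (w^~ om) t|%:R < T].
Proof.
move=> snr0 t0 T0 sep.
pose v (q : 'I_n * 'I_k) := vsubv (theta q.2) (theta (z q.1)).
pose a (q : 'I_n * 'I_k) om := (q.2 != z q.1) &&
  (t * normv (v q) ^+ 2 <= dotv (v q) (w q.1 om)).
have ma q : measurable [set om | a q om].
  rewrite /a; case: (_ != _) => /=; last first.
    by rewrite (_ : [set _ | _] = set0)//; apply/seteqP; split.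
  by apply: measurable_set_ge; exact: measurable_dotv.
have pa q : (P [set om | a q om] <= (expR (- (2 * t ^+ 2 * snr ^+ 2)))%:E)%E.
  rewrite /a; case: (boolP (_ != _)) => /= [ne|_]; last first.
    by rewrite (_ : [set _ | _] = set0) ?measure0 ?lee_fin ?expR_ge0//; apply/seteqP; split.
  rewrite sqr_normv; apply: le_trans (dotv_tail _ s0 t0 (wsub q.1)) _.
  rewrite lee_fin ler_expR lerN2 ler_pdivlMr ?mulr_gt0 ?exprn_gt0//.
  have D : (2 * sigma * snr) ^+ 2 <= sqnormv (v q).
    rewrite -sqr_normv lerXn2r ?nnegrE ?normv_ge0//; last exact: sep.
    by rewrite mulr_ge0// mulr_ge0// ltW.
  have -> : 2 * t ^+ 2 * snr ^+ 2 * (2 * sigma ^+ 2) = t ^+ 2 * (2 * sigma * snr) ^+ 2 by ring.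
  by rewrite ler_wpM2l// sqr_ge0.
have [mB PB] := markov_card ma T0 pa.
exists [set om | T <= #|[set j | a j om]%SET|%:R]; split => //.
  by apply: le_trans PB _; rewrite sumr_const card_prod !card_ord -[_ *+ _]mulr_natl.
by move=> om /= /negP; rewrite -ltNge.
Qed.

Lemma large_noise_event (snr rho T : R) : 0 < T ->
  exists B : set Omega, [/\ measurable B,
  (P B <= (n%:R * expR (4 * d%:R - snr ^+ 2 * rho) / T)%:E)%E &
  forall om, ~ B om ->
    #|[set i | ((2 * sigma * snr) ^+ 2 * rho <= sqnormv (w i om))%R]%SET|%:R < T].
Proof.
move=> T0; pose a i om := (2 * sigma * snr) ^+ 2 * rho <= sqnormv (w i om).
have ma i : measurable [set om | a i om].
  by apply: measurable_set_ge; apply: measurable_sum => j; exact: measurable_funX.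
have pa i : (P [set om | a i om] <= (expR (4 * d%:R - snr ^+ 2 * rho))%:E)%E.
  have [mX [_ [_ mgf]]] := wsub i.
  have := @norm_tail _ _ _ P d (w i) sigma (4 * snr ^+ 2 * rho) s0 mX mgf.
  rewrite /a.
  have -> : 4 * snr ^+ 2 * rho * sigma ^+ 2 = (2 * sigma * snr) ^+ 2 * rho by ring.
  by have -> : 4 * snr ^+ 2 * rho / 4 = snr ^+ 2 * rho by field.
have [mB PB] := markov_card ma T0 pa.
exists [set om | T <= #|[set j | a j om]%SET|%:R]; split => //.
  by apply: le_trans PB _; rewrite sumr_const card_ord -[_ *+ _]mulr_natl.
by move=> om /= /negP; rewrite -ltNge.
Qed.

End model.

(** * Degenerate cases and numerical estimates *)

Lemma alpha_gt0_nonempty (R : realType) n k (z : 'I_n -> 'I_k) : 0 < alpha R z -> (0 < n)%N.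
Proof.
rewrite /alpha /fmin; case: pickP => [i0 _|_]; last by rewrite ltxx.
(* With [n = 0] every proportion is 0 by the convention on division. *)
case: n z => // z gt0.
have := lt_le_trans gt0 (bigmin_le_cond _ _ (isT : predT i0)).
by rewrite invr0 mulr0 ltxx.
Qed.

Lemma le_nstar (R : realType) n k (z : 'I_n -> 'I_k) g : (0 < n)%N ->
  n%:R * alpha R z <= (nstar z g)%:R.
Proof.
move=> n0; rewrite mulrC -ler_pdivlMr ?ltr0n//.
exact: (@fmin_le R _ predT (fun g => (nstar z g)%:R / n%:R) g isT).
Qed.

(** Without a pair of distinct labels, [fmin] takes its default value 0. *)
Lemma Delta_gt0_two_clusters (R : realType) k d (theta : 'I_k -> vec R d) :
  0 < Delta theta -> (1 < k)%N.
Proof.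
rewrite /Delta /fmin; case: pickP => [[g h] /= ne _|_]; last by rewrite ltxx.
by have := ltn_ord g; have := ltn_ord h; move: ne; rewrite -val_eqE /=; lia.
Qed.

Lemma le_expR_self (R : realType) (x : R) : x <= expR x.
Proof. by apply: le_trans (expR_ge1Dx _); lra. Qed.

Section numerics.
Context (R : realType) (n d k : nat) (a delta S rho kap eps rate : R).
Hypothesis rhoE : rho = Num.sqrt delta * S * Num.sqrt (a / d%:R).
Hypothesis kapE : kap = Num.sqrt delta * S * Num.sqrt (a / (1 + d%:R * k%:R / n%:R)).
Hypothesis epsE : eps = 22 / Num.sqrt kap.
Hypothesis rateE : rate = expR (- (1 / 2) * (1 - 68 / Num.sqrt rho) * S ^+ 2).
Hypothesis n0 : (0 < n)%N.
Hypothesis d0 : (0 < d)%N.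
Hypothesis kn : (k <= n)%N.
Hypothesis a0 : 0 < a.
Hypothesis ka1 : k%:R * a <= 1.
Hypothesis a1 : a <= 1.
Hypothesis dl0 : 0 < delta.
Hypothesis dl1 : delta <= 1.
Hypothesis S0 : 0 < S.
Hypothesis rhoC : 200 ^+ 2 < rho.

Let n0R : 0 < n%:R :> R. Proof. by rewrite ltr0n. Qed.
Let d0R : 0 < d%:R :> R. Proof. by rewrite ltr0n. Qed.
Let d1R : 1 <= d%:R :> R. Proof. by rewrite ler1n. Qed.
Let dkn0 : 0 <= d%:R * k%:R / n%:R :> R. Proof. by rewrite divr_ge0// mulr_ge0. Qed.

Lemma sqrt_rho_ge : 200 <= Num.sqrt rho.
Proof.
have h : 0 <= 200 :> R by [].
by rewrite -[leLHS](ger0_norm h) -sqrtr_sqr ler_wsqrtr// ltW.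
Qed.

Let rho1 : 1 <= rho.
Proof. by apply: le_trans (ltW rhoC); apply: exprn_ege1; rewrite ler1n. Qed.

Lemma rho_sqr : rho ^+ 2 * d%:R = delta * S ^+ 2 * a.
Proof.
rewrite rhoE !exprMn !sqr_sqrtr ?ltW// ?divr_gt0//.
by rewrite mulrA divfK// gt_eqF.
Qed.

Lemma kap_sqr : kap ^+ 2 * (1 + d%:R * k%:R / n%:R) = delta * S ^+ 2 * a.
Proof.
have h : 0 < 1 + d%:R * k%:R / n%:R :> R by have := dkn0; lra.
rewrite kapE !exprMn !sqr_sqrtr ?ltW// ?divr_gt0//.
by rewrite mulrA divfK// gt_eqF.
Qed.

Let kap_ge0 : 0 <= kap.
Proof. by rewrite kapE !mulr_ge0 ?sqrtr_ge0// ltW. Qed.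

Let da : delta * a <= 1.
Proof. by rewrite -[1]mulr1 ler_pM// ltW. Qed.

Lemma dim_le_snr : d%:R <= delta * S ^+ 2 * a.
Proof. by rewrite -rho_sqr -[leLHS]mul1r ler_pM2r// expr2; have := rho1; nra. Qed.

Let daS_le : delta * S ^+ 2 * a <= S ^+ 2.
Proof.
have -> : delta * S ^+ 2 * a = delta * a * S ^+ 2 by ring.
by rewrite -[leRHS]mul1r ler_wpM2r// sqr_ge0.
Qed.

(** This follows from [k a <= 1] and [1 <= d <= S^2 a]; it lets exponentials in [S] absorb the
    number of clusters. *)
Let k_le : k%:R <= S ^+ 2.
Proof.
have ha : 1 <= S ^+ 2 * a.
  apply: le_trans d1R _; apply: le_trans dim_le_snr _.
  by rewrite -mulrA -[leRHS]mul1r ler_wpM2r// mulr_ge0 ?sqr_ge0// ltW.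
by rewrite -(ler_pM2r a0); apply: le_trans ka1 _.
Qed.

Lemma rho_le_snr : rho <= S.
Proof.
rewrite -(@ler_pXn2r _ 2)// ?nnegrE ?(ltW S0)//; last by have := rho1; lra.
apply: le_trans daS_le; rewrite -rho_sqr -[leLHS]mulr1.
by rewrite ler_wpM2l ?sqr_ge0.
Qed.

Lemma kap_le_snr : kap <= S.
Proof.
rewrite -(@ler_pXn2r _ 2)// ?nnegrE ?(ltW S0)//.
apply: le_trans daS_le; rewrite -kap_sqr -[leLHS]mulr1.
by rewrite ler_wpM2l ?sqr_ge0// lerDl.
Qed.

(** Since [k <= n], the factor [1 + d k / n] is at most [4 d], whence [rho <= 2 kap]. *)
Lemma sqrt_kap_ge : 100 <= Num.sqrt kap.
Proof.
have kn1 : d%:R * k%:R / n%:R <= d%:R :> R.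
  by rewrite ler_pdivrMr// ler_pM2l// ler_nat.
have E : kap ^+ 2 * (1 + d%:R * k%:R / n%:R) = rho ^+ 2 * d%:R.
  by rewrite kap_sqr rho_sqr.
have h : rho ^+ 2 * d%:R <= kap ^+ 2 * (4 * d%:R).
  by rewrite -E ler_wpM2l ?sqr_ge0//; have := d1R; lra.
have h2 : rho ^+ 2 <= (2 * kap) ^+ 2.
  rewrite -(ler_pM2r d0R); apply: le_trans h _.
  by rewrite le_eqVlt; apply/orP; left; apply/eqP; ring.
have h3 : rho <= 2 * kap.
  rewrite -(@ler_pXn2r _ 2)// ?nnegrE ?mulr_ge0//.
  by have := rho1; lra.
have h4 : 0 <= 100 :> R by [].
rewrite -[leLHS](ger0_norm h4) -sqrtr_sqr ler_wsqrtr//.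
have := rhoC; have -> : 200 = 2 * 100 :> R by ring.
by rewrite exprMn; lra.
Qed.

Let kap1 : 1 <= kap.
Proof.
by rewrite -(sqr_sqrtr kap_ge0); apply: exprn_ege1; have := sqrt_kap_ge; lra.
Qed.

Let S1 : 1 <= S. Proof. exact: le_trans kap1 kap_le_snr. Qed.

Lemma eps_gt0 : 0 < eps.
Proof. by rewrite epsE divr_gt0//; have := sqrt_kap_ge; lra. Qed.

Lemma eps_le : eps <= 1 / 4.
Proof. by rewrite epsE ler_pdivrMr; have := sqrt_kap_ge; lra. Qed.

Lemma eps_sqr : eps ^+ 2 * kap = 22 ^+ 2.
Proof.
rewrite epsE expr_div_n sqr_sqrtr// divfK//.
by rewrite gt_eqF//; have := kap1; lra.
Qed.

(** This is the estimate that dictates [kap] and the constant 22. After multiplication by [kap * a],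
    the bound [k a <= 1] reduces the left side to [40 kap nh (1 + d k / n)], while
    [eps^2 kap = 22^2] makes the right side [kap^2 nh (1 + d k / n) 22^2 / 8]. *)
Lemma few_stray_points (nh : R) : n%:R * a <= nh ->
  20 * (k%:R * nh + n%:R + 2 * k%:R * d%:R) / (eps ^+ 2 * S ^+ 2) <= nh * delta / 8.
Proof.
move=> nanh.
have k1 := kap1.
have nh0 : 0 < nh by apply: lt_le_trans nanh; rewrite mulr_gt0.
rewrite ler_pdivrMr; last by rewrite mulr_gt0 ?exprn_gt0// eps_gt0.
rewrite -(ler_pM2r (_ : 0 < kap * a)); last by rewrite mulr_gt0//; lra.
have -> : nh * delta / 8 * (eps ^+ 2 * S ^+ 2) * (kap * a) =
  nh / 8 * (eps ^+ 2 * kap) * (delta * S ^+ 2 * a) by ring.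
rewrite eps_sqr -kap_sqr; set x := d%:R * k%:R / n%:R.
have -> : 20 * (k%:R * nh + n%:R + 2 * k%:R * d%:R) * (kap * a) =
  kap * (20 * (k%:R * a * nh + n%:R * a + 2 * (n%:R * a * x))).
  by rewrite /x; field; rewrite gt_eqF.
have -> : nh / 8 * 22 ^+ 2 * (kap ^+ 2 * (1 + x)) = kap * (kap * (nh * (1 + x) * 22 ^+ 2 / 8)) by field.
rewrite ler_pM2l; last by lra.
have x0 : 0 <= x by exact: dkn0.
have h1 : k%:R * a * nh <= nh by rewrite -[leRHS]mul1r ler_pM2r.
have h2 : n%:R * a * x <= nh * x by rewrite ler_wpM2r.
have h3 : 0 <= nh * x by rewrite mulr_ge0// ltW.
nra.
Qed.

(** The prefactor [16 k / (a delta)] is at most [(2 S)^4 <= expR (8 S)]. As [kap <= S], the exponent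
    [eps^2 S^2 / 2] is at least [242 S]. *)
Lemma crossing_eps_prob :
  (n * k)%:R * expR (- (2 * (eps / 2) ^+ 2 * S ^+ 2)) / (n%:R * a * delta / 16)
    <= expR (- (S / 4)).
Proof.
have k1 := kap1.
have h0 : 1 <= S ^+ 2 * (a * delta).
  by apply: le_trans d1R _; apply: le_trans dim_le_snr _; rewrite le_eqVlt; apply/orP; left; apply/eqP; ring.
have kle := k_le.
have ad0 : 0 < a * delta by rewrite mulr_gt0.
have E : eps ^+ 2 * S >= 22 ^+ 2.
  rewrite -eps_sqr ler_wpM2l ?sqr_ge0//; exact: kap_le_snr.
rewrite ler_pdivrMr; last by rewrite divr_gt0// !mulr_gt0.
have -> : expR (- (S / 4)) * (n%:R * a * delta / 16) =
  n%:R * (expR (- (S / 4)) * (a * delta / 16)) by ring.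
rewrite natrM -mulrA ler_pM2l//.
rewrite -(ler_pM2r (_ : 0 < 16 * S ^+ 2)); last by rewrite mulr_gt0// exprn_gt0.
apply: (@le_trans _ _ (expR (- (S / 4)))); last first.
  have -> : expR (- (S / 4)) * (a * delta / 16) * (16 * S ^+ 2) =
    expR (- (S / 4)) * (S ^+ 2 * (a * delta)) by field.
  by rewrite -[leLHS]mulr1 ler_pM2l// expR_gt0.
apply: (@le_trans _ _ ((2 * S) ^+ 4 * expR (- (242 * S)))).
  have -> : k%:R * expR (- (2 * (eps / 2) ^+ 2 * S ^+ 2)) * (16 * S ^+ 2) =
    k%:R * (16 * S ^+ 2) * expR (- (2 * (eps / 2) ^+ 2 * S ^+ 2)) by ring.
  apply: ler_pM; rewrite ?expR_ge0//.
  - by rewrite mulr_ge0// mulr_ge0// sqr_ge0.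
  - have -> : (2 * S) ^+ 4 = S ^+ 2 * (16 * S ^+ 2) by ring.
    by rewrite ler_wpM2r// mulr_ge0// sqr_ge0.
  - rewrite ler_expR lerN2.
    have -> : 2 * (eps / 2) ^+ 2 * S ^+ 2 = eps ^+ 2 * S * S / 2 by field.
    nra.
apply: (@le_trans _ _ (expR (2 * S) ^+ 4 * expR (- (242 * S)))).
  rewrite ler_pM2r ?expR_gt0// lerXn2r ?nnegrE ?expR_ge0 ?le_expR_self// mulr_ge0// ltW//.
by rewrite -expRM_natl -expRD ler_expR; have := S0; lra.
Qed.

(** The Chernoff exponent loses at most [60 / q] by squaring [1 - 30 / q], whereas [rate] concedes
    [68 / q]. The difference is worth [4 S^2 / q >= 4 S], which pays for the prefactor
    [2 k <= expR (3 S)] and for [expR (- (S / 4))]. *)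
Lemma crossing_rate_prob :
  (n * k)%:R * expR (- (2 * ((1 - 30 / Num.sqrt rho) / 2) ^+ 2 * S ^+ 2)) /
    (n%:R * rate / 2) <= expR (- (S / 4)).
Proof.
rewrite rateE; have sr := sqrt_rho_ge; pose q : R := Num.sqrt rho; rewrite -/q in sr *.
have q0 : 0 < q by lra.
have qn0 : q != 0 by rewrite gt_eqF.
have kle := k_le.
have qS : q <= S.
  apply: le_trans rho_le_snr; rewrite -[leRHS](@sqr_sqrtr _ rho); last by have := rho1; lra.
  by rewrite -/q; nra.
rewrite ler_pdivrMr; last by rewrite divr_gt0// mulr_gt0// expR_gt0.
rewrite [leRHS](_ : _ = n%:R * (expR (- (S / 4)) * expR (- (1 / 2) * (1 - 68 / q) * S ^+ 2) / 2)); last by ring.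
rewrite natrM -mulrA ler_pM2l// ler_pdivlMr// -expRD.
apply: (@le_trans _ _ (expR S * expR S * expR S * expR (- (2 * ((1 - 30 / q) / 2) ^+ 2 * S ^+ 2)))).
  rewrite mulrAC ler_pM2r ?expR_gt0//.
  have e1 := le_expR_self S; have e2 : 2 <= expR S.
    by apply: le_trans (expR_ge1Dx _); lra.
  have e3 : S ^+ 2 <= expR S * expR S by rewrite expr2; apply: ler_pM => //; exact: ltW.
  by apply: ler_pM => //; apply: le_trans e3.
rewrite -!expRD ler_expR.
have E : 68 / q - 60 / q = 8 / q by ring.
have h : (1 - 30 / q) ^+ 2 >= 1 - 60 / q.
  have -> : 60 / q = 2 * (30 / q) by ring.
  by have := sqr_ge0 (30 / q); nra.
have h8 : S <= S ^+ 2 / q by rewrite ler_pdivlMr// expr2 ler_pM2l.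
have -> : 2 * ((1 - 30 / q) / 2) ^+ 2 * S ^+ 2 = (1 - 30 / q) ^+ 2 * S ^+ 2 / 2 by field.
have h9 : (1 - 60 / q) * S ^+ 2 <= (1 - 30 / q) ^+ 2 * S ^+ 2 by rewrite ler_wpM2r ?sqr_ge0.
have -> : - (1 / 2) * (1 - 68 / q) * S ^+ 2 =
  - ((1 - 60 / q) * S ^+ 2 / 2) + 4 * (S ^+ 2 / q) by field.
lra.
Qed.

(** With [rho >= 200] and [d <= S^2], the term [S^2 rho] dominates [4 d], the exponent of [rate] and
    the linear terms in [S]. *)
Lemma large_noise_prob :
  n%:R * expR (4 * d%:R - S ^+ 2 * rho) / (n%:R * rate / 2) <= expR (- (S / 4)).
Proof.
rewrite rateE; have sr := sqrt_rho_ge.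
rewrite ler_pdivrMr; last by rewrite divr_gt0// mulr_gt0// expR_gt0.
rewrite [leRHS](_ : _ = n%:R * (expR (- (S / 4)) * expR (- (1 / 2) * (1 - 68 / Num.sqrt rho) * S ^+ 2) / 2)); last by ring.
rewrite ler_pM2l// ler_pdivlMr// -expRD.
apply: (@le_trans _ _ (expR (4 * d%:R - S ^+ 2 * rho) * expR S)).
  rewrite ler_wpM2l ?expR_ge0//; apply: (@le_trans _ _ (1 + S)); last exact: expR_ge1Dx.
  by have := S1; lra.
rewrite -!expRD ler_expR.
have dS : d%:R <= S ^+ 2.
  exact: le_trans dim_le_snr daS_le.
have SS : S <= S ^+ 2 by rewrite expr2 -[leLHS]mulr1 ler_pM2l//; exact: S1.
have SR : S ^+ 2 * 200 <= S ^+ 2 * rho.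
  by rewrite ler_wpM2l ?sqr_ge0//; move: rhoC; rewrite expr2; lra.
have rg : 0 <= 68 / Num.sqrt rho * S ^+ 2 by rewrite mulr_ge0 ?sqr_ge0// divr_ge0// sqrtr_ge0.
have -> : - (1 / 2) * (1 - 68 / Num.sqrt rho) * S ^+ 2 =
  - (S ^+ 2 / 2) + 68 / Num.sqrt rho * S ^+ 2 / 2.
  by field; rewrite gt_eqF//; lra.
have := S0; lra.
Qed.

End numerics.

(** * Deterministic convergence on the good event *)

Section convergence.
Context (R : realType) (n d k m : nat) (z : 'I_n -> 'I_k) (theta : 'I_k -> vec R d)
  (w : 'I_n -> vec R d) (pt : 'I_n + 'I_m -> vec R d)
  (sigma D a delta S rho kap eps rate : R).
Hypothesis rhoE : rho = Num.sqrt delta * S * Num.sqrt (a / d%:R).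
Hypothesis kapE : kap = Num.sqrt delta * S * Num.sqrt (a / (1 + d%:R * k%:R / n%:R)).
Hypothesis epsE : eps = 22 / Num.sqrt kap.
Hypothesis DE : D = 2 * sigma * S.
Hypothesis n0 : (0 < n)%N.
Hypothesis d0 : (0 < d)%N.
Hypothesis kn : (k <= n)%N.
Hypothesis a0 : 0 < a.
Hypothesis ka1 : k%:R * a <= 1.
Hypothesis dl0 : 0 < delta.
Hypothesis dl1 : delta <= 1.
Hypothesis S0 : 0 < S.
Hypothesis s0 : 0 < sigma.
Hypothesis rhoC : 200 ^+ 2 < rho.
Hypothesis mE : m%:R = n%:R * a * (1 - delta).
Hypothesis na_le : forall g, n%:R * a <= (nstar z g)%:R.
Hypothesis ptE : forall i, pt (inl i) = vaddv (theta (z i)) (w i).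
Hypothesis sep : forall g h, g != h -> D <= normv (vsubv (theta g) (theta h)).
Hypothesis energy : forall j, \sum_i w i j ^+ 2 <= 20 * n%:R * sigma ^+ 2.
Hypothesis sums : forall A : {set 'I_n}, forall g, (forall i, i \in A -> z i = g) ->
  sqnormv (fun j => \sum_(i in A) w i j) <=
    20 * sigma ^+ 2 * #|A|%:R * ((nstar z g)%:R + d%:R).
Hypothesis few_crossings : #|crossing z theta w (eps / 2)|%:R < n%:R * a * delta / 16.

Let n0R : 0 < n%:R :> R. Proof. by rewrite ltr0n. Qed.
Let d0R : 0 < d%:R :> R. Proof. by rewrite ltr0n. Qed.
Let D0 : 0 < D. Proof. by rewrite DE !mulr_gt0. Qed.
Let rho0 : 0 < rho. Proof. by apply: lt_trans rhoC; apply: exprn_gt0. Qed.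

(** An excess of [n a delta / 2] correct labels in [cmedian_dev] bounds the squared error by
    [80 d sigma^2 / (a delta)], below [(5 D / rho)^2 = 100 d sigma^2 / (a delta)]. *)
Lemma step_accuracy (zh : 'I_n + 'I_m -> 'I_k) (th : 'I_k -> vec R d) :
  (forall x h, sqnormv (vsubv (pt x) (th (zh x))) <= sqnormv (vsubv (pt x) (th h))) ->
  (forall h, normv (vsubv (th h) (theta h)) <= (1 / 2 - eps) * D) ->
  forall h, normv (vsubv (cmedian (cluster_pts pt zh h)) (theta h)) <= 5 * D / rho.
Proof.
move=> lab thr h.
have e0 : 0 < eps by apply: (@eps_gt0 R n d k a delta S rho kap eps).
have e4 : eps <= 1 / 4 by apply: (@eps_le R n d k a delta S rho kap eps).
have e2 : eps <= 1 / 2 by lra.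
have K0 : 0 <= 20 :> R by [].
have := step_counts ptE lab sep s0 S0 DE h e0 e2 K0 sums thr.
have : 20 * (k%:R * (nstar z h)%:R + n%:R + 2 * k%:R * d%:R) / (eps ^+ 2 * S ^+ 2)
    <= (nstar z h)%:R * delta / 8.
  by apply: (@few_stray_points R n d k a delta S rho kap eps).
rewrite mE; set Q := 20 * _ / _; set N := (nstar z h)%:R; set NH := (nh zh h)%:R.
set NHH := (nhg z zh h h)%:R; set c := #|_|%:R => hQ cnt.
have hN : n%:R * a <= N by exact: na_le.
(* The outliers leave at least [N * delta] of the majority; the stray points and the crossings each
   remove at most an eighth of it. *)
have key : n%:R * a * delta / 2 <= 2 * NHH - NH.
  have h1 : 0 <= (N - n%:R * a) * (1 - delta) by rewrite mulr_ge0 ?subr_ge0.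
  have h2 : n%:R * a * delta <= N * delta by rewrite ler_pM2r.
  have h3 : c < n%:R * a * delta / 16 by exact: few_crossings.
  have h4 : 0 < n%:R * a * delta by rewrite !mulr_gt0.
  lra.
have := cmedian_dev zh h ptE energy; rewrite -/NHH -/NH.
set e := vsubv _ _ => dev.
have X0 := sqnormv_ge0 e.
have aX : a * delta * sqnormv e <= 80 * d%:R * sigma ^+ 2.
  rewrite -(ler_pM2l n0R).
  have : n%:R * a * delta / 2 * sqnormv e <= (2 * NHH - NH) * sqnormv e by rewrite ler_wpM2r.
  lra.
rewrite ler_pdivlMr// -(@ler_pXn2r _ 2)// ?nnegrE ?mulr_ge0 ?normv_ge0 ?(ltW rho0) ?(ltW D0)//.
rewrite exprMn sqr_normv -(ler_pM2r d0R) -mulrA.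
have -> : rho ^+ 2 * d%:R = delta * S ^+ 2 * a by apply: (@rho_sqr R d a delta S rho).
have -> : sqnormv e * (delta * S ^+ 2 * a) = S ^+ 2 * (a * delta * sqnormv e) by ring.
have -> : (5 * D) ^+ 2 * d%:R = S ^+ 2 * (100 * d%:R * sigma ^+ 2) by rewrite DE; ring.
rewrite ler_pM2l ?exprn_gt0//; apply: le_trans aX _.
have : 0 < d%:R * sigma ^+ 2 by rewrite mulr_gt0 ?exprn_gt0.
lra.
Qed.

(** The two ratios in [Hs] give an excess of at least [2 eta NH >= 2 eta NHH >= eta N]. The constant
    160 in [eta] is the one for which [cmedian_dev] yields exactly [D / 4]. *)
Lemma label_init_accuracy (zh : 'I_n + 'I_m -> 'I_k) :
  1 / 2 + 160 / (S * Num.sqrt (a / d%:R)) ^+ 2 <= Hs R z zh ->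
  forall h, normv (vsubv (cmedian (cluster_pts pt zh h)) (theta h)) <= D / 4.
Proof.
move=> H h; set eta := 160 / _ in H.
have etaE : eta * (S ^+ 2 * a) = 160 * d%:R.
  rewrite /eta exprMn sqr_sqrtr ?divr_ge0// ?ltW//.
  by field; rewrite !gt_eqF.
have eta0 : 0 < eta.
  by rewrite /eta divr_gt0// exprn_gt0// mulr_gt0// sqrtr_gt0 divr_gt0.
have := le_trans H (@fmin_le R _ predT _ h isT).
rewrite le_min => /andP[H1 H2].
set NHH := (nhg z zh h h)%:R in H1 H2; set N := (nstar z h)%:R in H1; set NH := (nh zh h)%:R in H2.
have hN : n%:R * a <= N by exact: na_le.
have N0 : 0 < N by apply: lt_le_trans hN; rewrite mulr_gt0.
(* An empty cluster would have ratio 0 by the convention on division, below [1 / 2]. *)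
have NH0 : 0 < NH.
  rewrite lt_neqAle ler0n andbT; apply/eqP => NHz.
  by move: H2; rewrite -NHz invr0 mulr0; lra.
rewrite ler_pdivlMr// in H1; rewrite ler_pdivlMr// in H2.
have HH : NHH <= NH.
  rewrite ler_nat nhgE nhE; apply: (@card_imset_le _ _ inl) => [i j []//|i].
  by rewrite !inE => /andP[].
have key : eta * (n%:R * a) <= 2 * NHH - NH.
  have h1 : eta * N <= 2 * (eta * NHH).
    have etaN : 0 < eta * N by rewrite mulr_gt0.
    by rewrite [leRHS]mulrCA ler_pM2l//; lra.
  have h2 : eta * (n%:R * a) <= eta * N by rewrite ler_pM2l.
  have h3 : eta * NHH <= eta * NH by rewrite ler_pM2l.
  lra.
have := cmedian_dev zh h ptE energy; rewrite -/NHH -/NH.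
set e := vsubv _ _ => dev.
have X0 := sqnormv_ge0 e.
have aX : eta * a * sqnormv e <= 40 * d%:R * sigma ^+ 2.
  rewrite -(ler_pM2l n0R).
  have : eta * (n%:R * a) * sqnormv e <= (2 * NHH - NH) * sqnormv e by rewrite ler_wpM2r.
  lra.
rewrite ler_pdivlMr// -(@ler_pXn2r _ 2)// ?nnegrE ?mulr_ge0 ?normv_ge0 ?(ltW D0)//.
rewrite exprMn sqr_normv -(ler_pM2r d0R).
have : S ^+ 2 * (eta * a * sqnormv e) <= S ^+ 2 * (40 * d%:R * sigma ^+ 2).
  by rewrite ler_wpM2l ?sqr_ge0.
have -> : S ^+ 2 * (eta * a * sqnormv e) = eta * (S ^+ 2 * a) * sqnormv e by ring.
rewrite etaE DE.
have -> : (2 * sigma * S) ^+ 2 * d%:R = 4 * (S ^+ 2 * (d%:R * sigma ^+ 2)) by ring.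
lra.
Qed.

Hypothesis few_rate_crossings :
  #|crossing z theta w ((1 - 30 / Num.sqrt rho) / 2)|%:R < n%:R * rate / 2.
Hypothesis few_large_noises :
  #|[set i | ((2 * sigma * S) ^+ 2 * rho <= sqnormv (w i))%R]%SET|%:R < n%:R * rate / 2.

Lemma run_accuracy (zh : nat -> 'I_n + 'I_m -> 'I_k) (th : nat -> 'I_k -> vec R d) :
  kmed_run pt zh th ->
  (forall h, normv (vsubv (th 0%N h) (theta h)) <= (1 / 2 - eps) * D) ->
  forall s, (2 <= s)%N -> misl R (zh s) z <= rate.
Proof.
move=> [thE lab] init.
have rho20 : 20 <= rho by apply: le_trans (ltW rhoC); rewrite expr2; lra.
have e4 : eps <= 1 / 4 by apply: (@eps_le R n d k a delta S rho kap eps).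
(* The accuracy after one step is again admissible as input of [step_accuracy], so it persists by
   induction. *)
have contract : 5 * D / rho <= (1 / 2 - eps) * D.
  rewrite ler_pdivrMr// -mulrA [D * rho]mulrC mulrA ler_pM2r//.
  have : (1 / 2 - 1 / 4) * rho <= (1 / 2 - eps) * rho by rewrite ler_pM2r//; lra.
  lra.
have close s : forall h, normv (vsubv (th s.+1 h) (theta h)) <= 5 * D / rho.
  elim: s => [|s IH] h; rewrite thE//.
    by apply: step_accuracy init _; exact: lab.
  by apply: step_accuracy (fun h => le_trans (IH h) contract) _; exact: lab.
(* The sharp accuracy starts with the centroids of step 1, which determine the labels of step 2. *)
move=> [|[|s]] // _.
rewrite mislE ler_pdivrMr//.
have r1 : 1 <= rho by lra.
have r2 : 10 / rho <= 1 by rewrite ler_pdivrMr//; lra.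
have := misl_le_crossing ptE (lab s.+1) sep s0 S0 DE r1 r2 (close s).
rewrite -(ler_nat R) natrD DE => /le_trans; apply.
by have := few_rate_crossings; have := few_large_noises; lra.
Qed.

End convergence.

(** * Combination of the exceptional events and choice of constants *)

Lemma probability_setU_le (R : realType) dm (Omega : measurableType dm)
    (P : probability Omega R) (A B : set Omega) (x y : R) :
  measurable A -> measurable B -> (P A <= x%:E)%E -> (P B <= y%:E)%E ->
  (P (A `|` B) <= (x + y)%:E)%E.
Proof.
move=> mA mB Ax By; apply: le_trans (measureU2 _ mA mB) _.
by rewrite EFinD leeD.
Qed.

Lemma probability_setC_ge (R : realType) dm (Omega : measurableType dm)
    (P : probability Omega R) (B : set Omega) (x : R) :
  measurable B -> (P B <= x%:E)%E -> ((1 - x)%:E <= P (~` B))%E.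
Proof.
by move=> mB Bx; rewrite probability_setC// EFinB leeB.
Qed.


Theorem theorem1 (R : realType) :
  exists C c0 c1 c2 c4 : R,
    0 < C /\ 0 < c0 /\ 0 < c1 /\ 0 < c2 /\ 0 < c4 /\
  forall (n d k : nat) (z : 'I_n -> 'I_k) (theta : 'I_k -> vec R d) (sigma : R)
    (dm : measure_display) (Omega : measurableType dm) (P : probability Omega R)
    (w : 'I_n -> Omega -> vec R d) (nout : nat) (delta : R),
    0 < sigma ->
    mutually_independent P w ->
    (forall i, subgaussian_zero_mean P (w i) sigma) ->
    0 < delta <= 1 ->
    nout%:R = n%:R * alpha R z * (1 - delta) ->
    c0 * ln n%:R <= n%:R * alpha R z ->
    C < Num.sqrt delta * SNR theta sigma * Num.sqrt (alpha R z / d%:R) ->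
    (* the adversary chooses the outliers after seeing Y_1, ..., Y_n *)
    forall adv : ('I_n -> vec R d) -> 'I_nout -> vec R d,
    exists E : set Omega, measurable E /\
      ((1 - 4%:R * (k ^ 2 + k)%:R * n%:R ^- 4
          - 16%:R * d%:R * n%:R ^+ 4 * expR (- (3%:R / 10%:R) * n%:R)
          - 2%:R * k%:R ^+ 2 * expR (- (SNR theta sigma / 4%:R)))%:E <= P E)%E /\
      forall om, E om ->
        let Y : 'I_n -> vec R d := fun i => vaddv (theta (z i)) (w i om) in
        let pt : 'I_n + 'I_nout -> vec R d :=
          fun x => match x with inl i => Y i | inr j => adv Y j end in
        forall (zh : nat -> 'I_n + 'I_nout -> 'I_k) (th : nat -> 'I_k -> vec R d),
          kmed_run pt zh th ->
          ((forall h, th 0%N h = cmedian (cluster_pts pt (zh 0%N) h)) /\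
             Hs R z (zh 0%N) >= 1 / 2 + c1 / (SNR theta sigma * Num.sqrt (alpha R z / d%:R)) ^+ 2
           \/ Lambdas theta (th 0%N) <=
                1 / 2 - c2 / Num.sqrt (Num.sqrt delta * SNR theta sigma *
                                Num.sqrt (alpha R z / (1 + d%:R * k%:R / n%:R)))) ->
          forall s : nat, (2 <= s)%N ->
            misl R (zh s) z <=
              expR (- (1 / 2) * (1 - c4 / Num.sqrt (Num.sqrt delta * SNR theta sigma
                                                   * Num.sqrt (alpha R z / d%:R)))
                    * SNR theta sigma ^+ 2).
Proof.
(* The first constant gives [sqrt rho >= 200], hence [eps <= 1 / 4] and [30 / sqrt rho < 1]; 1
   serves the union over subsets of a cluster; 160 and 22 make either initialization accurate to
   [(1 / 2 - eps) * Delta]; 68 is fixed by [crossing_rate_prob]. *)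
exists (200 ^+ 2), 1, 160, 22, 68; do 5 (split; first by rewrite ?exprn_gt0).
move=> n d k z theta sigma dm Omega P w m delta s0 wind wsub /andP[dl0 dl1] mE lnE rhoC adv.
set a := alpha R z in mE lnE rhoC *; set S := SNR theta sigma in rhoC *.
pose rho := Num.sqrt delta * S * Num.sqrt (a / d%:R).
pose kap := Num.sqrt delta * S * Num.sqrt (a / (1 + d%:R * k%:R / n%:R)).
pose eps := 22 / Num.sqrt kap.
pose rate := expR (- (1 / 2) * (1 - 68 / Num.sqrt rho) * S ^+ 2).
rewrite -/rho in rhoC.
have rho0 : 0 < rho by apply: lt_trans rhoC; exact: exprn_gt0.
have sd0 : 0 < Num.sqrt delta by rewrite sqrtr_gt0.
(* Positivity of [rho] excludes the degenerate cases: it forces [S], [a] and [d] to be positive, and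
   then [n > 0] and [k >= 2]. *)
have [S0 ad0] : 0 < S /\ 0 < a / d%:R.
  have h : 0 <= Num.sqrt (a / d%:R) by exact: sqrtr_ge0.
  have S0 : 0 < S.
    rewrite ltNge; apply/negP => Sle; move: rho0; rewrite ltNge /rho -mulrA.
    by rewrite mulr_ge0_le0 ?(ltW sd0)// mulr_le0_ge0.
  split => //; rewrite -sqrtr_gt0 lt_neqAle h andbT; apply/eqP => E.
  by move: rho0; rewrite /rho -E mulr0 ltxx.
have d0 : (0 < d)%N.
  by rewrite lt0n; apply/eqP => E; move: ad0; rewrite E invr0 mulr0 ltxx.
have a0 : 0 < a by move: ad0; rewrite pmulr_lgt0// invr_gt0 ltr0n.
have n0 : (0 < n)%N by exact: alpha_gt0_nonempty a0.
have n0R : 0 < n%:R :> R by rewrite ltr0n.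
have na_le g : n%:R * a <= (nstar z g)%:R by exact: le_nstar.
have DE : Delta theta = 2 * sigma * S.
  by rewrite /S /SNR mulrC divfK// gt_eqF// mulr_gt0.
clearbody S.
have D0 : 0 < Delta theta by rewrite DE mulr_gt0// mulr_gt0.
have k2 : (1 < k)%N by exact: Delta_gt0_two_clusters D0.
have sep g h : g != h -> Delta theta <= normv (vsubv (theta g) (theta h)).
  move=> gh; exact: (@fmin_le R _ _ (fun p => normv (vsubv (theta p.1) (theta p.2))) (g, h)).
have ka1 : k%:R * a <= 1.
  rewrite -(ler_pM2l n0R) mulr1 -[in leRHS](sum_nstar z) natr_sum mulrCA.
  rewrite -[X in X%:R * _]card_ord mulr_natl -sumr_const.
  by apply: ler_sum.
have k1R : 1 <= k%:R :> R by rewrite ler1n ltnW.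
have a1 : a <= 1 by apply: le_trans ka1; rewrite -[leLHS]mul1r ler_wpM2r// ltW.
have kn : (k <= n)%N.
  rewrite -[X in (_ <= X)%N](sum_nstar z) -[X in (X <= _)%N]card_ord -sum1_card.
  apply: leq_sum => g _; rewrite -(ltr_nat R).
  by apply: lt_le_trans (na_le g); rewrite mulr_gt0.
have lnn g : ln n%:R <= (nstar z g)%:R :> R.
  by apply: le_trans (na_le g); move: lnE; rewrite mul1r.
have eps0 : 0 < eps by apply: (@eps_gt0 R n d k a delta S rho kap eps).
have eps4 : eps <= 1 / 4 by apply: (@eps_le R n d k a delta S rho kap eps).
have sr : 200 <= Num.sqrt rho by exact: sqrt_rho_ge.
have rate0 : 0 < rate by exact: expR_gt0.
have sep' g h : g != h -> 2 * sigma * S <= normv (vsubv (theta g) (theta h)).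
  by rewrite -DE; exact: sep.
have [B1 [mB1 PB1 HB1]] := coordinate_energy_event s0 wind wsub.
have [B2 [mB2 PB2 HB2]] := partial_sums_event s0 wind wsub n0 lnn.
have T3 : 0 < n%:R * a * delta / 16 by rewrite divr_gt0// !mulr_gt0.
have t3 : 0 <= eps / 2 by rewrite divr_ge0// ltW.
have T4 : 0 < n%:R * rate / 2 by rewrite divr_gt0// mulr_gt0.
have [B3 [mB3 PB3 HB3]] := crossing_event z s0 wsub (ltW S0) t3 T3 sep'.
have t4 : 0 <= (1 - 30 / Num.sqrt rho) / 2.
  rewrite divr_ge0// subr_ge0 ler_pdivrMr; lra.
have [B4 [mB4 PB4 HB4]] := crossing_event z s0 wsub (ltW S0) t4 T4 sep'.
have [B5 [mB5 PB5 HB5]] := large_noise_event s0 wsub S rho T4.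
have {}PB3 : (P B3 <= (expR (- (S / 4)))%:E)%E.
  apply: le_trans PB3 _; rewrite lee_fin.
  by apply: (@crossing_eps_prob R n d k a delta S rho kap eps).
have {}PB4 : (P B4 <= (expR (- (S / 4)))%:E)%E.
  apply: le_trans PB4 _; rewrite lee_fin.
  by apply: (@crossing_rate_prob R n d k a delta S rho rate).
have {}PB5 : (P B5 <= (expR (- (S / 4)))%:E)%E.
  apply: le_trans PB5 _; rewrite lee_fin.
  by apply: (@large_noise_prob R n d k a delta S rho kap rate).
(* The event restricts the noise alone, so it covers whatever the adversary adds, every tie-breaking
   and every initialization. *)
exists (~` (B1 `|` (B2 `|` (B3 `|` (B4 `|` B5))))); split.
  by apply: measurableC; do !apply: measurableU.
split.
  have mB45 : measurable (B4 `|` B5) by exact: measurableU.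
  have mB345 : measurable (B3 `|` (B4 `|` B5)) by exact: measurableU.
  have mB25 : measurable (B2 `|` (B3 `|` (B4 `|` B5))) by exact: measurableU.
  apply: le_trans (probability_setC_ge (measurableU _ _ mB1 mB25)
    (probability_setU_le mB1 mB25 PB1 (probability_setU_le mB2 mB345 PB2
      (probability_setU_le mB3 mB45 PB3 (probability_setU_le mB4 mB5 PB4 PB5))))).
  rewrite lee_fin.
  have n1 : 1 <= n%:R :> R by rewrite ler1n.
  have b1 : d%:R * expR (- n%:R) <= 16 * d%:R * n%:R ^+ 4 * expR (- (3 / 10) * n%:R) :> R.
    apply: ler_pM; rewrite ?expR_ge0//; last by rewrite ler_expR; lra.
    rewrite mulrAC -[leLHS]mul1r ler_wpM2r//.
    by have := exprn_ege1 4 n1; lra.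
  have b2 : k%:R * n%:R ^- 4 <= 4 * (k ^ 2 + k)%:R * n%:R ^- 4 :> R.
    rewrite ler_wpM2r ?invr_ge0 ?exprn_ge0//.
    by rewrite natrD natrX; have := sqr_ge0 (k%:R : R); lra.
  (* Three events cost [expR (- (S / 4))] each, and [k >= 2] gives [2 k^2 >= 8]. *)
  have b3 : 3 * expR (- (S / 4)) <= 2 * k%:R ^+ 2 * expR (- (S / 4)).
    rewrite ler_pM2r ?expR_gt0//.
    have k2R : 2 <= k%:R :> R by rewrite ler_nat.
    by have := ler_pM (ler0n R 2) (ler0n R 2) k2R k2R; rewrite expr2; lra.
  lra.
move=> om nB Y pt zh th run init.
have {}HB1 := HB1 om (fun h => nB (or_introl h)).
have {}HB2 := HB2 om (fun h => nB (or_intror (or_introl h))).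
have {}HB3 := HB3 om (fun h => nB (or_intror (or_intror (or_introl h)))).
have {}HB4 := HB4 om (fun h => nB (or_intror (or_intror (or_intror (or_introl h))))).
have {}HB5 := HB5 om (fun h => nB (or_intror (or_intror (or_intror (or_intror h))))).
apply: (@run_accuracy R n d k m z theta (w^~ om) pt sigma (Delta theta) a delta S rho kap eps rate
  erefl erefl erefl DE n0 d0 kn a0 ka1 dl0 dl1 S0 s0 rhoC mE na_le (fun=> erefl) sep
  HB1 HB2 HB3 HB4 HB5 zh th run).
(* Initial labels give centroid error [Delta / 4], admissible since [eps <= 1 / 4]; for initial
   centroids the assumption on [Lambdas] is the required bound divided by [Delta]. *)
move=> h; case: init => [[th0 H]|L].
  have := @label_init_accuracy R n d k m z theta (w^~ om) pt sigma (Delta theta) a S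
    DE n0 d0 a0 S0 s0 na_le (fun=> erefl) HB1 _ H h.
  by rewrite th0 => /le_trans; apply; rewrite [leLHS]mulrC ler_pM2r//; lra.
have := @le_fmax R _ predT (fun h => normv (vsubv (th 0%N h) (theta h)) / Delta theta) h isT.
by move=> /le_trans/(_ L); rewrite ler_pdivrMr.
Qed.
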